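(* Let $f:\mathbb R^n\to\mathbb R$ be locally Lipschitz continuous, let $N\subset\mathbb R^n$ be an $\mathcal L^n$-null set, and let $x\in\mathbb R^n$. Then $$\partial f(x)=\operatorname{conv}\Big\{\lim_{k\to\infty}Df(x_k)\ :\ x_k\to x,\ x_k\in D_f\setminus N,\ \lim_{k\to\infty}Df(x_k)\text{ exists}\Big\}=\langle\mathrm{Dens}_x,Df\rangle,$$ where $\operatorname{conv}$ denotes the convex hull.
   Context: $\mathcal L^n$ is Lebesgue measure on $\mathbb R^n$. $D_f$ is the set of points at which $f$ is differentiable; by Rademacher's theorem $Df$ exists $\mathcal L^n$-a.e. and $Df\in L^\infty_{\rm loc}(\mathbb R^n,\mathbb R^n)$. The Clarke generalized directional derivative is $f^\circ(x;v)=\limsup_{y\to x,\ t\downarrow0}\frac{f(y+tv)-f(y)}{t}$ and the generalized gradient is $\partial f(x)=\{w\in\mathbb R^n: w\cdot v\le f^\circ(x;v)\text{ for all }v\in\mathbb R^n\}$ (the dual of $\mathbb R^n$ is identified with $\mathbb R^n$). $\mathrm{Dens}_x$ is the set of density measures at $x$ on $\mathbb R^n$: all bounded finitely additive set functions $\mu$ on the Borel sets $\mathcal B(\mathbb R^n)$ with $\mu\ge0$, $\mu(A)=0$ whenever $\mathcal L^n(A)=0$, and $\mu(B_\delta(x))=\mu(\mathbb R^n)=1$ for all $\delta>0$ ($B_\delta(x)$ the open ball). For such $\mu$, integrals are with respect to the finitely additive measure $\mu$ (for bounded functions, by uniform approximation with simple functions), and $\langle\mathrm{Dens}_x,Df\rangle=\{\int_{B_\delta(x)}Df\,d\mu:\mu\in\mathrm{Dens}_x\}\subset\mathbb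 R^n$, with integrals taken componentwise; the value is the same for every $\delta>0$ because $\mu(\mathbb R^n\setminus B_\delta(x))=0$. *)

(* Defs.v *)
From HB Require Import structures.
From mathcomp Require Import all_boot all_order all_algebra.
From mathcomp Require Import all_classical all_reals all_analysis.
Set Implicit Arguments.
Unset Strict Implicit.
Unset Printing Implicit Defensive.
Import Order.TTheory GRing.Theory Num.Theory.
Import numFieldNormedType.Exports HBSimple.

Local Open Scope classical_set_scope.
Local Open Scope ring_scope.

(* Points and gradients are row vectors 'rV[R]_n.  The library equips 'rV[R]_n
   with the sup norm: it is used only through notions that do not depend on the
   choice of a norm (convergence, differentiability, local Lipschitz
   continuity, open sets).  Balls are Euclidean, see [eball]. *)

Section euclidean.
Context {R : realType} {n : nat}.
Implicit Types (x v w : 'rV[R]_n).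

Definition dotp v w : R := \sum_(i < n) v ord0 i * w ord0 i.

Definition enorm v : R := Num.sqrt (dotp v v).

Definition eball x (delta : R) : set 'rV[R]_n :=
  [set y | enorm (y - x) < delta].

End euclidean.

Definition conv_hull {R : realType} {V : lmodType R} (A : set V) : set V :=
  [set w | exists (m : nat) (a : 'I_m -> R) (p : 'I_m -> V),
    [/\ forall i, 0 <= a i, \sum_(i < m) a i = 1, forall i, A (p i)
      & w = \sum_(i < m) a i *: p i]].

Notation borel_rV R n := (g_sigma_algebraType (@open 'rV[R]_n)).

(* Lebesgue measure on the Borel subsets of R^n, as the n-fold product of the
   one-dimensional one: L^0 is the unit mass on R^0 = {0}, and L^(n+1) is the
   image of L^1 \x L^n under (t, v) |-> (t, v_0, ..., v_(n-1)).  Only its values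
   on Borel sets are meaningful; a general subset of R^n is Lebesgue-null iff it
   is [negligible], i.e. contained in a Borel set of measure 0. *)
Fixpoint lebesgue_rV (R : realType) (n : nat) : set (borel_rV R n) -> \bar R :=
  match n return set (borel_rV R n) -> \bar R with
  | 0 => dirac (0 : borel_rV R 0)
  | m.+1 => fun A => (lebesgue_measure \x @lebesgue_rV R m)%E
      [set p : R * borel_rV R m | A (row_mx p.1%:M p.2 : 'rV[R]_(1 + m))]
  end.

Section generalized_gradient.
Context {R : realType} {n : nat}.
Implicit Types (f : 'rV[R]_n -> R) (x v : 'rV[R]_n).

Definition locally_lipschitz f : Prop :=
  forall x, exists2 U, nbhs x U & [lipschitz f y | y in U].

(* The gradient, set to 0 off the set of points of differentiability. *)
Definition grad f x : 'rV[R]_n :=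
  if `[< differentiable f x >] then \row_(i < n) 'd f x (delta_mx ord0 i)
  else 0.

Definition clarke_dd f x v : \bar R :=
  limf_esup (fun p : 'rV[R]_n * R => ((f (p.1 + p.2 *: v) - f p.1) / p.2)%:E)
    (filter_prod (nbhs x) (at_right 0)).

Definition clarke_gradient f x : set 'rV[R]_n :=
  [set w | forall v, ((dotp w v)%:E <= clarke_dd f x v)%E].

Definition limiting_gradients f (N : set 'rV[R]_n) x : set 'rV[R]_n :=
  [set w | exists xs : nat -> 'rV[R]_n,
    [/\ xs @ \oo --> x,
        forall k, differentiable f (xs k) /\ ~ N (xs k)
      & (fun k => grad f (xs k)) @ \oo --> w]].

End generalized_gradient.

Section density_measures.
Context {R : realType} {n : nat}.
Local Notation E := (borel_rV R n).

(* A content is nonnegative and finitely additive on the measurable (here Borel)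
   sets; boundedness follows from mu setT = 1. *)
Definition density_measure (x : 'rV[R]_n) : set {content set E -> \bar R} :=
  [set mu | [/\ forall A : set E,
                  measurable A -> lebesgue_rV A = 0%E -> mu A = 0%E,
                forall delta, 0 < delta -> mu (eball x delta) = 1%E
              & mu setT = 1%E]].

(* [fa_integral mu B g c] says that g is mu-integrable over B with integral c:
   g is on B the uniform limit of Borel simple functions whose elementary
   integrals over B converge to c.  If mu B is finite, c does not depend on the
   simple functions. *)
Definition fa_integral (mu : {content set E -> \bar R}) (B : set E)
    (g : E -> R) (c : R) : Prop :=
  exists s : nat -> {sfun E >-> R},
    {uniform B, (fun k => s k : E -> R) @ \oo --> g} /\
    (fun k => sintegral (fun A => mu (B `&` A)) (s k)) @ \oo --> c%:E.

(* The componentwise integrals of Df; the values of [grad] off the (null) set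
   of points of non-differentiability are irrelevant since mu vanishes on
   Lebesgue-null Borel sets. *)
Definition density_integrals (f : 'rV[R]_n -> R) (x : 'rV[R]_n) :
    set 'rV[R]_n :=
  [set w | exists2 mu, density_measure x mu &
    forall (delta : R) (i : 'I_n), 0 < delta ->
      fa_integral mu (eball x delta) (fun y => grad f y ord0 i) (w ord0 i)].

End density_measures.

(* Main.v *)
Require Import Defs.
From HB Require Import structures.
From mathcomp Require Import all_boot all_order all_algebra finmap.
From mathcomp Require Import all_classical all_reals all_analysis.
From mathcomp Require Import unstable measurable_realfun lra ring.
Import Order.TTheory GRing.Theory Num.Theory.
Import numFieldNormedType.Exports HBSimple.
Set Implicit Arguments.
Unset Strict Implicit.
Unset Printing Implicit Defensive.
Local Open Scope classical_set_scope.
Local Open Scope ring_scope.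

(** The three sets are compared in a cycle: Clarke's gradient lies in the set of
density integrals ([clarke_sub_density]), which lies in the convex hull of the
limiting gradients ([density_sub_conv_hull]), which lies in Clarke's gradient
([conv_hull_sub_clarke]).

The first two inclusions are tested one direction v at a time.  If C is convex
and bounded, and if sup_(c in C) c.v >= w.v for every v, then C comes
arbitrarily close to w ([approx_separation]); when C is moreover closed, it
contains w.

- From Clarke's gradient to density integrals.  Let w be in Clarke's gradient.
  Some difference quotient of f in the direction v, taken near x, is at least
  w.v - e.  By Rademacher's theorem and dominated convergence, the average of f
  over a cube moving in the direction v has the average of Df.v as derivative.
  By the mean value theorem there are thus small cubes near x over which the
  average of Df.v is at least w.v - e ([cube_int_slope], [cube_mean]).  The
  uniform measures on such cubes vanish on null sets and concentrate at x.
  Their setwise limit along an ultrafilter need not be countably additive, but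
  it is a density measure at x, and it integrates Df to some w' with
  w'.v >= w.v ([density_limit]).  The same limit argument shows that the set of
  density integrals is closed.

- From density integrals to the convex hull.  A density measure at x gives mass
  one to every ball around x deprived of N and of the points where f is not
  differentiable.  Hence Df.v cannot stay below w.v - e there, and the
  gradients at well-chosen points accumulate at a limiting gradient whose
  product with v is at least w.v - e.  The limiting gradients form a compact
  set, so their convex hull is closed by Caratheodory's theorem
  ([conv_hull_closed]).

- From the convex hull to Clarke's gradient.  Df(y).v is a limit of difference
  quotients at y, and this survives limits in y and convex combinations.

Rademacher's theorem is proved by induction on the dimension
([rademacher]).  On the line, a Lipschitz function becomes, after scaling and
addition of a multiple of the identity, a nondecreasing function whose Stieltjes
measure is absolutely continuous, that is, an indefinite integral.  For f on
R x R^m, at almost every point f is derivable in the first variable and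
differentiable in the others; these partial differentials have to be assembled
into a differential at the point.  The gradient of f(s, .) is however only given
on the slice through the point.  It is transported to nearby slices through the
countably many sets T of those s for which f(s, .) is nearly affine, with a
given rational gradient and precision: at almost every point of T the distance
to T, being Lipschitz, is derivable, hence has derivative 0, so that each nearby
slice is at a distance o(s) of a slice in T ([slice_gradient]). *)

(** * Lipschitz functions of one variable *)

Section rademacher_line.
Context {R : realType}.
Notation leb := (@lebesgue_measure R).

Lemma stieltjes_itv_oc (h : cumulative R R) (a b : R) : a <= b ->
  lebesgue_stieltjes_measure h `]a, b]%classic = (h b - h a)%:E.
Proof.
move=> ab; rewrite /lebesgue_stieltjes_measure /measure_extension.
by rewrite measurable_mu_extE/=; [rewrite wlength_itv_bnd|exact: is_ocitv].
Qed.

(** If h and k are nondecreasing with h + k = id, then the sum of their Stieltjes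
    measures is Lebesgue measure, so each of them is absolutely continuous. *)
Lemma stieltjes_dominated (h k : cumulative R R) : (forall t, h t + k t = t) ->
  lebesgue_stieltjes_measure h `<< leb.
Proof.
move=> hk.
have leq A : measurable A ->
    leb A = measure_add (lebesgue_stieltjes_measure h)
                        (lebesgue_stieltjes_measure k) A.
  apply: lebesgue_stieltjes_measure_unique => X /ocitvP[->|[[a b]/= ab ->]].
    by rewrite !measure0.
  rewrite [RHS]measure_addE [LHS]stieltjes_itv_oc ?(ltW ab)//.
  apply: (etrans _ (esym (congr2 (fun x y => x + y)%E
    (stieltjes_itv_oc h (ltW ab)) (stieltjes_itv_oc k (ltW ab))))).
  rewrite -EFinD; congr EFin; rewrite /= -[in LHS](hk b) -[in LHS](hk a).
  ring.
apply/null_content_dominatesP => A mA A0.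
have := etrans (esym (leq A mA)) A0; rewrite measure_addE => /eqP.
by rewrite padde_eq0 ?measure_ge0// => /andP[/eqP].
Qed.

(** By [stieltjes_dominated], h is on a bounded interval the indefinite integral
    of a Radon-Nikodym density; Lebesgue's differentiation theorem applies. *)
Lemma ae_derivable_cumulative (h k : cumulative R R) (u v : R) :
  (forall t, h t + k t = t) ->
  {ae leb, forall t, u < t < v -> derivable h t 1}.
Proof.
move=> hk.
have [uv|vu] := ltP u v; last first.
  apply: aeW => t /andP[ut tv]; exfalso.
  by move: (lt_trans ut tv); rewrite ltNge vu.
have muv : measurable (`]u, v]%classic : set (measurableTypeR R)) by [].
have fuv : (lebesgue_stieltjes_measure h `]u, v]%classic < +oo)%E.
  by rewrite stieltjes_itv_oc ?(ltW uv)// ltry.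
(* the restriction to a bounded interval makes the measure finite, as the
   Radon-Nikodym theorem requires *)
pose nu := mfrestr muv fuv.
have nule : nu `<< leb.
  have /null_content_dominatesP dom := stieltjes_dominated hk.
  apply/null_content_dominatesP => A mA A0.
  rewrite /nu /mfrestr /mrestr; apply/eqP; rewrite -measure_le0.
  rewrite -(dom A mA A0); apply: le_measure; rewrite ?inE//.
  exact: measurableI.
have [phi [phi0 phifin phiint phiE]] := radon_nikodym_sigma_finite nule.
pose f t := fine (phi t).
have fE : EFin \o f = phi by apply/funext => t; rewrite /= fineK.
have fint : leb.-integrable [set: R] (EFin \o f) by rewrite fE.
have := @FTC1Ny R f _ (open_integrable_locally openT fint).
have fint' y : leb.-integrable `]-oo, y] (EFin \o f).
  apply: integrableS fint; [exact: measurableT|exact: measurable_itv|].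
  exact: subsetT.
move=> /(_ fint').
apply: filterS; first exact: (ae_filter_ringOfSetsType leb).
move=> t [dF _] /andP[ut tv].
apply: near_eq_derivable (derivableD (derivable_cst (h u) t 1) dF).
near=> s.
have us : u <= s by apply: ltW; near: s; exact: lt_nbhsr.
have sv : s <= v by apply: ltW; near: s; exact: lt_nbhsl.
rewrite /= fctE /= /Rintegral.
rewrite (eq_integral phi); last by move=> r _; rewrite /= -[in RHS]fE.
rewrite -phiE//= /mfrestr /mrestr.
rewrite (_ : _ `&` _ = `]u, s]%classic); last first.
  apply/seteqP; split => r; rewrite /= !in_itv/=.
    by move=> [rs /andP[->]].
  by move=> /andP[-> rs]; split => //; rewrite (le_trans rs sv).
by rewrite stieltjes_itv_oc//= addrC subrK.
Unshelve. all: by end_near. Qed.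

Lemma ae_forall_countable d (T : measurableType d) (mu : {measure set T -> \bar R})
    (I : countType) (P : I -> T -> Prop) :
  (forall i, {ae mu, forall x, P i x}) -> {ae mu, forall x i, P i x}.
Proof.
move=> aeP.
have : {ae mu, forall x (k : nat), forall i, @choice.unpickle I k = Some i -> P i x}.
  apply: ae_foralln => k; case: (@choice.unpickle I k) => [j|]; last exact: aeW.
  apply: filterS.
    by move=> x Pjx i [<-]; exact: Pjx.
  exact: aeP.
apply: filterS.
by move=> x + i => /(_ (choice.pickle i) i); apply; rewrite choice.pickleK.
Qed.

Lemma derivable_affine (g h : R -> R) (c t : R) :
  (forall s, g s = c * (h s - s / 2)) -> derivable h t 1 -> derivable g t 1.
Proof.
move=> gE dh.
have -> : g = c *: (h - (2^-1 : R) *: (@id R)).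
  by apply/funext => s; rewrite gE; congr (_ * (_ - _)); exact: mulrC.
by apply: derivableZ; apply: derivableB.
Qed.

(** Once g is rescaled to be 1/2-Lipschitz, t / 2 + g and t / 2 - g are both
    nondecreasing, and they add up to t. *)
Lemma ae_derivable_lipschitz (g : R -> R) (K : R) :
  (forall s t, `|g s - g t| <= K * `|s - t|) ->
  {ae leb, forall t, derivable g t 1}.
Proof.
move=> gK.
pose C : R := 2 * (`|K| + 1); have C0 : 0 < C by rewrite /C; have := normr_ge0 K; lra.
have gC s t : `|g s / C - g t / C| <= `|s - t| / 2.
  rewrite -mulrBl normrM normfV (gtr0_norm C0) ler_pdivrMr//.
  rewrite (le_trans (gK _ _))//.
  have := ler_wpM2r (normr_ge0 (s - t)) (ler_norm K).
  have := normr_ge0 (s - t); rewrite /C; lra.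
(* c is meant to be 1/2 or -1/2, for the functions t / 2 + g t / C and t / 2 -
   g t / C *)
have cont (c : R) : `|c| <= 1/2 -> continuous (fun t : R => t / 2 + c * 2 * (g t / C)).
  move=> c1 t; apply/cvgrPdist_le => e e0; near=> s.
  have st : `|t - s| <= e.
    by near: s; exact: cvgr_dist_le.
  have -> : t / 2 + c * 2 * (g t / C) - (s / 2 + c * 2 * (g s / C)) =
    (t - s) / 2 + c * 2 * (g t / C - g s / C) by ring.
  rewrite (le_trans (ler_normD _ _))// !normrM.
  have := gC t s; have := normr_ge0 (t - s).
  have : `|c| * `|2| * `|g t / C - g s / C| <= 1 * `|g t / C - g s / C|.
    by apply: ler_wpM2r => //; rewrite (ger0_norm (_ : 0 <= 2 :> R))//; lra.
  rewrite normfV (ger0_norm (_ : 0 <= 2 :> R))//; lra.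
have mono (c : R) : `|c| = 1/2 -> nondecreasing (fun t : R => t / 2 + c * 2 * (g t / C)).
  move=> c1 s t st.
  have := gC t s; rewrite (@ger0_norm _ (t - s)) ?subr_ge0// ler_norml.
  move: c1 => /eqP; rewrite eqr_norml => /andP[/orP[] /eqP -> _] /andP[]; lra.
have cont' (c : R) : `|c| = 1/2 ->
    right_continuous (fun t : R => t / 2 + c * 2 * (g t / C)).
  by move=> c1; apply: right_continuousW; apply: cont; rewrite c1.
have p2 : `|1/2| = 1/2 :> R by rewrite ger0_norm; lra.
have m2 : `|-(1/2)| = 1/2 :> R by rewrite normrN.
pose h : cumulative R R := HB.pack (fun t : R => t / 2 + 1/2 * 2 * (g t / C))
  (isCumulative.Build R _ R _ (mono _ p2) (cont' _ p2)).
pose k : cumulative R R := HB.pack (fun t : R => t / 2 + -(1/2) * 2 * (g t / C))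
  (isCumulative.Build R _ R _ (mono _ m2) (cont' _ m2)).
have hk t : h t + k t = t by rewrite /h /k /=; lra.
have : {ae leb, forall t (m : nat), - m%:R < t < m%:R -> derivable h t 1}.
  by apply: ae_foralln => m; exact: ae_derivable_cumulative hk.
apply: filterS; first exact: (ae_filter_ringOfSetsType leb).
move=> t /(_ (Num.bound t)); rewrite -ltr_norml ltr_norm_bound => /(_ isT) dh.
have cancelE (a b c : R) : c != 0 -> a = c * (b / 2 + 1/2 * 2 * (a / c) - b / 2).
  by move=> c0; field.
by apply: derivable_affine dh => s; exact/cancelE/lt0r_neq0.
Unshelve. all: by end_near. Qed.

Lemma clamp_dist (p q s t : R) :
  `|Num.max p (Num.min q s) - Num.max p (Num.min q t)| <= `|s - t|.
Proof.
wlog st : s t / s <= t.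
  by move=> W; have [/W//|/ltW/W] := leP s t; rewrite distrC (distrC t).
have maxD a b c : 0 <= c -> Num.max a (b + c) <= Num.max a b + c :> R.
  move=> c0; rewrite ge_max lerD2r le_max lexx orbT andbT.
  by rewrite (@le_trans _ _ (Num.max a b))// ?lerDl// le_max lexx.
have minD a b c : 0 <= c -> Num.min a (b + c) <= Num.min a b + c :> R.
  by move=> c0; rewrite addr_minl le_min ge_min lerDl c0/= ge_min lexx orbT.
have ts0 : 0 <= t - s by rewrite subr_ge0.
rewrite distrC ger0_norm ?(distrC s) ?(ger0_norm ts0).
  rewrite lerBlDl; apply: le_trans (maxD _ _ _ ts0).
  rewrite ge_max !le_max lexx/=; apply/orP; right.
  by apply: le_trans (minD _ _ _ ts0); rewrite subrKC.
rewrite subr_ge0 ge_max le_max lexx/= le_max le_min !ge_min lexx/= st !orbT//.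
Qed.

(** Every point has a rational interval around it on which g is Lipschitz; there
    g coincides with the globally Lipschitz map obtained by clamping the
    argument to the interval. *)
Lemma ae_derivable_locally_lipschitz (g : R -> R) :
  (forall t, exists r K, 0 < r /\ forall s s', `|s - t| < r -> `|s' - t| < r ->
     `|g s - g s'| <= K * `|s - s'|) ->
  {ae leb, forall t, derivable g t 1}.
Proof.
move=> gloc.
have : {ae leb, forall t (i : rat * rat), (exists K, forall s s' : R,
     ratr i.1 <= s <= ratr i.2 -> ratr i.1 <= s' <= ratr i.2 ->
     `|g s - g s'| <= K * `|s - s'|) -> ratr i.1 < t < ratr i.2 -> derivable g t 1}.
  apply: ae_forall_countable => -[a b]/=.
  move: (ratr a) (ratr b) => p q {a b}.
  have [qp|pq] := ltP q p.
    apply: aeW => t _ /andP[pt tq]; exfalso.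
    by move: (lt_trans pt tq); rewrite ltNge (ltW qp).
  have [[K gK]|noK] := pselect (exists K, forall s s' : R,
     p <= s <= q -> p <= s' <= q -> `|g s - g s'| <= K * `|s - s'|); last first.
    by apply: aeW => t.
  pose cl (t : R) := Num.max p (Num.min q t).
  have clin t : p <= cl t <= q by rewrite /cl le_max lexx/= ge_max pq ge_min lexx.
  have clL s t : `|cl s - cl t| <= `|s - t| := clamp_dist p q s t.
  have := @ae_derivable_lipschitz (g \o cl) `|K|.
  have LL s t : `|(g \o cl) s - (g \o cl) t| <= `|K| * `|s - t|.
    rewrite /= (le_trans (gK _ _ (clin _) (clin _)))//.
    by rewrite (le_trans (ler_wpM2r _ (ler_norm K)))// ler_wpM2l.
  move=> /(_ LL); apply: filterS; first exact: (ae_filter_ringOfSetsType leb).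
  move=> t + _ /andP[pt tq]; apply: near_eq_derivable.
  near=> s; rewrite /= /cl min_r ?max_r//.
    by apply: ltW; near: s; exact: lt_nbhsr.
  by apply: ltW; near: s; exact: lt_nbhsl.
apply: filterS; first exact: (ae_filter_ringOfSetsType leb).
move=> t H; have [r [K [r0 rK]]] := gloc t.
have [p] : exists p : rat, ratr p \in `](t - r), t[.
  by apply: rat_in_itvoo; lra.
have [q] : exists q : rat, ratr q \in `]t, (t + r)[.
  by apply: rat_in_itvoo; lra.
rewrite !in_itv/= => /andP[tq qr] /andP[rp pt].
apply: (H (p, q)); last by rewrite /= tq pt.
exists K => s s' /= /andP[s1 s2] /andP[s3 s4].
by apply: rK; rewrite ltr_norml; lra.
Unshelve. all: by end_near. Qed.

End rademacher_line.

(** * Coordinates of row vectors *)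

Section rV_coordinates.
Context {R : realType}.

Lemma rV_norm_coord n (v : 'rV[R]_n) i : `|v ord0 i| <= `|v|.
Proof.
rewrite [leRHS]/Num.norm /= mx_normrE.
by apply/bigmax_geP; right => /=; exists (ord0, i).
Qed.

Lemma rV_norm_le n (v : 'rV[R]_n) (r : R) :
  0 <= r -> (forall i, `|v ord0 i| <= r) -> `|v| <= r.
Proof.
move=> r0 vr; rewrite [leLHS]/Num.norm /= mx_normrE.
by apply/bigmax_leP; split => // -[i j] _ /=; rewrite (ord1 i).
Qed.

Lemma rV_norm_lt n (v : 'rV[R]_n) (r : R) :
  0 < r -> (forall i, `|v ord0 i| < r) -> `|v| < r.
Proof.
move=> r0 vr; rewrite [ltLHS]/Num.norm /= mx_normrE.
by apply/bigmax_ltP; split => // -[i j] _ /=; rewrite (ord1 i).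
Qed.

Lemma norm_delta_le1 n (i : 'I_n) : `|delta_mx ord0 i : 'rV[R]_n| <= 1.
Proof.
apply: rV_norm_le => // j; rewrite mxE eqxx.
by case: (_ && _); rewrite ?normr1 ?normr0.
Qed.

Lemma rV_eq n (u v : 'rV[R]_n) : (forall i, u ord0 i = v ord0 i) -> u = v.
Proof. by move=> uv; apply/rowP => i; exact: uv. Qed.

(** The map underlying the recursive definition of Lebesgue measure: its image is
    the product R x R^m seen as R^(m+1). *)
Definition consv m (t : R) (u : 'rV[R]_m) : 'rV[R]_m.+1 :=
  row_mx t%:M u : 'rV[R]_(1 + m).

Definition tailv m (v : 'rV[R]_m.+1) : 'rV[R]_m := rsubmx (v : 'rV[R]_(1 + m)).

Lemma consv0 m t (u : 'rV[R]_m) : consv t u ord0 ord0 = t.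
Proof.
rewrite /consv (_ : ord0 = lshift m (ord0 : 'I_1)); last exact: val_inj.
by rewrite (row_mxEl t%:M u) mxE eqxx mulr1n.
Qed.

Lemma consvS m t (u : 'rV[R]_m) i : consv t u ord0 (lift ord0 i) = u ord0 i.
Proof.
rewrite /consv (_ : lift ord0 i = rshift 1 i); last exact: val_inj.
by rewrite (row_mxEr t%:M u).
Qed.

Lemma tailvE m (v : 'rV[R]_m.+1) i : tailv v ord0 i = v ord0 (lift ord0 i).
Proof. by rewrite /tailv mxE; congr (v _ _); exact: val_inj. Qed.

Lemma consvK m (v : 'rV[R]_m.+1) : consv (v ord0 ord0) (tailv v) = v.
Proof.
apply/rV_eq => i; case: (unliftP ord0 i) => [j ->|->].
  by rewrite consvS tailvE.
by rewrite consv0.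
Qed.

Lemma tailvK m t (u : 'rV[R]_m) : tailv (consv t u) = u.
Proof. by apply/rV_eq => i; rewrite tailvE consvS. Qed.

Lemma consvD m s t (u v : 'rV[R]_m) : consv s u + consv t v = consv (s + t) (u + v).
Proof.
apply/rV_eq => i; rewrite mxE; case: (unliftP ord0 i) => [j ->|->].
  by rewrite !consvS mxE.
by rewrite !consv0.
Qed.

Lemma consvB m s t (u v : 'rV[R]_m) : consv s u - consv t v = consv (s - t) (u - v).
Proof.
apply/rV_eq => i; rewrite mxE [X in _ + X]mxE; case: (unliftP ord0 i) => [j ->|->].
  by rewrite !consvS !mxE.
by rewrite !consv0.
Qed.

Lemma consv_norm_lt m t (u : 'rV[R]_m) (r : R) :
  (`|consv t u| < r) = (`|t| < r) && (`|u| < r).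
Proof.
apply/idP/andP => [tur|[tr ur]].
  split.
    by apply: le_lt_trans tur; have := rV_norm_coord (consv t u) ord0; rewrite consv0.
  apply: le_lt_trans tur; apply: rV_norm_le => // i.
  by have := rV_norm_coord (consv t u) (lift ord0 i); rewrite consvS.
apply: rV_norm_lt => [|i]; first exact: le_lt_trans tr.
case: (unliftP ord0 i) => [j ->|->]; rewrite ?consvS ?consv0//.
exact: le_lt_trans (rV_norm_coord _ _) ur.
Qed.

Lemma rat_approx (t e : R) : 0 < e -> exists q : rat, `|t - ratr q| < e.
Proof.
move=> e0; have : t - e < t + e by lra.
move=> /rat_in_itvoo[q]; rewrite in_itv/= => /andP[q1 q2]; exists q.
by rewrite ltr_norml; lra.
Qed.

Lemma rV_rat_approx n (v : 'rV[R]_n) (e : R) : 0 < e ->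
  exists p : 'rV[rat]_n, `|v - map_mx ratr p| < e.
Proof.
move=> e0.
have /choice[p pP] : forall i, exists q : rat, `|v ord0 i - ratr q| < e.
  by move=> i; exact: rat_approx.
by exists (\row_i p i); apply: rV_norm_lt => // i; have := pP i; rewrite !mxE.
Qed.

Lemma open_rV_norm n (A : set 'rV[R]_n) :
  (forall x, A x -> exists2 e, 0 < e & forall y, `|y - x| < e -> A y) -> open A.
Proof.
move=> Aop; rewrite openE => x /Aop[e e0 eA]; apply/nbhs_ballP; exists e => //= y.
by rewrite -ball_normE/= distrC; exact: eA.
Qed.

Lemma open_rV_normP n (A : set 'rV[R]_n) x : open A -> A x ->
  exists2 e, 0 < e & forall y, `|y - x| < e -> A y.
Proof.
rewrite openE => /(_ x) /[apply] /nbhs_ballP[e /= e0 eA]; exists e => // y yx.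
by apply: eA; rewrite -ball_normE/= distrC.
Qed.

End rV_coordinates.

(** * Borel sets and Lebesgue measure on row vectors *)

Section lebesgue_rV_measure.
Context {R : realType}.
Notation leb := (@lebesgue_measure R).

Lemma open_measurable_rV n (A : set 'rV[R]_n) :
  open A -> measurable (A : set (borel_rV R n)).
Proof. by move=> oA; apply: sub_sigma_algebra. Qed.

Lemma closed_measurable_rV n (A : set 'rV[R]_n) :
  closed A -> measurable (A : set (borel_rV R n)).
Proof.
move=> cA; rewrite -(setCK A); apply: measurableC.
by apply: open_measurable_rV; exact: closed_openC.
Qed.

Lemma continuous_measurable_rV n (g : 'rV[R]_n -> R) :
  continuous g -> measurable_fun [set: borel_rV R n] (g : borel_rV R n -> R).
Proof.
move=> cg; apply: (measurability _ (RGenOInfty.measurableE R)).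
move=> _ [_ [a ->] <-]; rewrite setTI; apply: open_measurable_rV.
rewrite (_ : _ @^-1` _ = g @^-1` [set t | a < t]); last first.
  by apply/seteqP; split => y; rewrite /= in_itv/= andbT.
by apply: open_comp => [y _|]; [exact: cg|exact: open_gt].
Qed.

Definition consp m (p : measurableTypeR R * borel_rV R m) : borel_rV R m.+1 :=
  consv p.1 p.2.

(** An open set of R^(m+1) is a countable union of rational boxes, and boxes are
    in the product of the two Borel sigma-algebras. *)
Lemma measurable_consp m : measurable_fun setT (@consp m).
Proof.
apply: measurability => //; move=> _ [U oU <-]; rewrite setTI.
pose small (i : rat * 'rV[rat]_m * nat) :=
  [set p : R * 'rV[R]_m | `|p.1 - ratr i.1.1| < i.2.+1%:R^-1 /\
                         `|p.2 - map_mx ratr i.1.2| < i.2.+1%:R^-1].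
have -> : @consp m @^-1` U =
    \bigcup_(i in [set i | small i `<=` @consp m @^-1` U]) small i.
  apply/seteqP; split => [[t u] Utu|p [i iU]]; last exact: iU.
  have [e e0 eU] := open_rV_normP oU Utu.
  have [k ke] : exists k, k.+1%:R^-1 < e / 2.
    have e2 : 0 < e / 2 by lra.
    by have [k _ /(_ k (leqnn k))] := near_infty_natSinv_lt (PosNum e2); exists k.
  have [h hE] : exists h : R, h = k.+1%:R^-1 by exists k.+1%:R^-1.
  have k0 : 0 < h by rewrite hE invr_gt0.
  rewrite -hE in ke.
  have [q qt] := rat_approx t k0.
  have [p pu] := rV_rat_approx u k0.
  exists (q, p, k); last by split; rewrite /= -hE.
  move=> [t' u'] /= []; rewrite -hE => t1 u1.
  apply: eU; rewrite /consp consvB consv_norm_lt; apply/andP; split.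
    by rewrite -(subrKA (ratr q)) (le_lt_trans (ler_normD _ _))// (distrC _ t); lra.
  rewrite -(subrKA (map_mx ratr p)) (le_lt_trans (ler_normD _ _))//.
  by rewrite (distrC _ u); lra.
rewrite bigcup_mkcond; apply: countable_bigcupT_measurable.
  exact: countableP.
move=> [[q p] k]; case: ifPn => // _.
rewrite (_ : small _ = [set t | `|t - ratr q| < k.+1%:R^-1] `*`
   [set u | `|u - map_mx ratr p| < k.+1%:R^-1]) //.
apply: measurableX.
  rewrite (_ : [set _ | _] =
      `](ratr q - k.+1%:R^-1), (ratr q + k.+1%:R^-1)[%classic); last first.
    by apply/seteqP; split => t; rewrite /= in_itv/= ltr_distl.
  exact: measurable_itv.
apply: open_measurable_rV; apply: open_rV_norm => u /= uq.
exists (k.+1%:R^-1 - `|u - map_mx ratr p|) => [|v vu]; first by rewrite subr_gt0.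
rewrite (_ : v - _ = (v - u) + (u - map_mx ratr p)); last by rewrite addrA subrK.
by rewrite (le_lt_trans (ler_normD _ _))// -ltrBrDr.
Qed.

Definition unconsp m (v : borel_rV R m.+1) : measurableTypeR R * borel_rV R m :=
  (v ord0 ord0, tailv v).

Lemma rV_continuous n k (g : 'rV[R]_n -> 'rV[R]_k) :
  (forall x e, 0 < e -> exists2 d, 0 < d &
     forall y, `|y - x| < d -> `|g y - g x| < e) -> continuous g.
Proof.
move=> gP x A /nbhs_ballP[e /= e0 eA]; have [d d0 gd] := gP x e e0.
apply/nbhs_ballP; exists d => //= y; rewrite -ball_normE/= distrC => xy.
by apply: eA; rewrite -ball_normE/= distrC; exact: gd.
Qed.

Lemma continuous_measurable_rV_rV n k (g : 'rV[R]_n -> 'rV[R]_k) :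
  continuous g -> measurable_fun [set: borel_rV R n] (g : borel_rV R n -> borel_rV R k).
Proof.
move=> cg; apply: measurability => //; move=> _ [U oU <-]; rewrite setTI.
by apply: open_measurable_rV; apply: open_comp => // y _; exact: cg.
Qed.

Lemma tailv_continuous m : continuous (@tailv R m).
Proof.
apply: rV_continuous => x e e0; exists e => // y /= yx.
apply: rV_norm_lt => // i; rewrite mxE [X in _ + X]mxE !tailvE.
apply: le_lt_trans yx; apply: le_trans (rV_norm_coord (y - x) (lift ord0 i)).
by rewrite !mxE.
Qed.

Lemma measurable_unconsp m : measurable_fun setT (@unconsp m).
Proof.
apply: measurable_fun_pair.
  by apply: continuous_measurable_rV; exact: coord_continuous.
by apply: continuous_measurable_rV_rV; exact: tailv_continuous.
Qed.

Section lebesgue_step.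
Variables (m : nat) (mu : {sigma_finite_measure set (borel_rV R m) -> \bar R}).

(** The recursion step of the definition of Lebesgue measure, for any
    sigma-finite measure on R^m: it is again a sigma-finite measure. *)
Definition lebesgue_step : set (borel_rV R m.+1) -> \bar R :=
  pushforward (leb \x mu)%E (@consp m).

Let step0 : lebesgue_step set0 = 0%E.
Proof. by rewrite /lebesgue_step /pushforward preimage_set0 measure0. Qed.

Let step_ge0 A : (0 <= lebesgue_step A)%E.
Proof. by rewrite /lebesgue_step /pushforward measure_ge0. Qed.

Let step_sigma_additive : semi_sigma_additive lebesgue_step.
Proof.
exact: (@measure_semi_sigma_additive _ _ _
  (measure_function_pushforward__canonical__measure_function_Measure
    (leb \x mu)%E (@measurable_consp m))).
Qed.

HB.instance Definition _ := isMeasure.Build _ _ _ lebesgue_step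
  step0 step_ge0 step_sigma_additive.

Let step_sigma_finite : sigma_finite setT lebesgue_step.
Proof.
have /sigma_finiteP[F [TF ndF Foo]] := sigma_finiteT leb.
have /sigma_finiteP[G [TG ndG Goo]] := sigma_finiteT mu.
exists (fun k => @unconsp m @^-1` (F k `*` G k)).
  apply/esym; rewrite -subTset => v _.
  have [k _ Fk] : (\bigcup_k F k) (v ord0 ord0) by rewrite -TF.
  have [l _ Gl] : (\bigcup_k G k) (tailv v) by rewrite -TG.
  exists (maxn k l) => //; split => /=.
    by move: (v ord0 ord0) Fk; exact/subsetPset/ndF/leq_maxl.
  by move: (tailv v) Gl; exact/subsetPset/ndG/leq_maxr.
move=> k; have [mF Fk] := Foo k; have [mG Gk] := Goo k.
split.
  by rewrite -[_ @^-1` _]setTI; apply: measurable_unconsp => //; exact: measurableX.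
rewrite /lebesgue_step /pushforward -comp_preimage.
rewrite (_ : _ \o _ = id); last first.
  by apply/funext => -[t u]; rewrite /unconsp /consp /= consv0 tailvK.
by rewrite preimage_id product_measure1E// lte_mul_pinfty// ge0_fin_numE.
Qed.

HB.instance Definition _ := @Measure_isSigmaFinite.Build _ _ _ lebesgue_step
  step_sigma_finite.

End lebesgue_step.

End lebesgue_rV_measure.

(** * Null sets *)

Section lebesgue_rV_theory.
Context {R : realType}.
Notation leb := (@lebesgue_measure R).

(** Lebesgue measure with its structure of sigma-finite measure, which the
    recursion needs at each step in order to form the product measure. *)
Fixpoint lebm (n : nat) : {sigma_finite_measure set (borel_rV R n) -> \bar R} :=
  match n with
  | 0 => dirac (0 : borel_rV R 0)
  | m.+1 => lebesgue_step (lebm m)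
  end.

Lemma lebmE n : lebm n = @lebesgue_rV R n :> (set (borel_rV R n) -> \bar R).
Proof.
by elim: n => [//|m IH]; rewrite /= -IH.
Qed.

Lemma lebm_ball n (r : R) : 0 < r ->
  (0 < lebm n [set v | `|v| < r]%R < +oo)%E.
Proof.
move=> r0; elim: n => [|m /andP[IH0 IHoo]].
  rewrite /= diracE mem_set ?lte01 ?ltry//=.
  by rewrite normr0.
have -> : lebm m.+1 [set v | `|v| < r]%R =
    (leb `](- r)%R, r[%classic * lebm m [set v | `|v| < r]%R)%E.
  rewrite -product_measure1E//; last first.
    apply: open_measurable_rV; apply: open_rV_norm => u /= ur.
    exists (r - `|u|) => [|v vu]; first by rewrite subr_gt0.
    by rewrite -(subrK u v) (le_lt_trans (ler_normD _ _))// -ltrBrDr.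
  rewrite /= /lebesgue_step /pushforward; congr (_ _).
  apply/seteqP; split => -[t u] /=.
    by rewrite /consp/= consv_norm_lt ltr_norml in_itv => /andP[].
  by rewrite /consp/= consv_norm_lt ltr_norml in_itv => -[-> ->].
have lr : leb `](- r), r[%classic = (r + r)%:E.
  by rewrite lebesgue_measure_itv/= lte_fin gtrN// -EFinB opprK.
rewrite lr mule_gt0 ?lte_fin ?addr_gt0//=.
by rewrite lte_mul_pinfty// lee_fin; lra.
Qed.

Section null_sections.
Variables (m : nat) (A : set (borel_rV R m.+1)).
Hypothesis mA : measurable A.

Let mA' : measurable (@consp R m @^-1` A).
Proof. by rewrite -[_ @^-1` _]setTI; exact: measurable_consp. Qed.

Let rowE t : xsection (@consp R m @^-1` A) t = [set u | A (consv t u)].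
Proof. by apply/seteqP; split => u; rewrite /xsection/= inE. Qed.

Let colE u : ysection (@consp R m @^-1` A) u = [set t | A (consv t u)].
Proof. by apply/seteqP; split => t; rewrite /ysection/= inE. Qed.

Lemma measurable_row t : measurable ([set u | A (consv t u)] : set (borel_rV R m)).
Proof. by rewrite -rowE; exact: measurable_xsection. Qed.

Lemma measurable_col u :
  measurable ([set t | A (consv t u)] : set (measurableTypeR R)).
Proof. by rewrite -colE; exact: measurable_ysection. Qed.

(** Tonelli's theorem: a Borel set is null iff almost all its slices are.  The
    slices are here those of fixed first coordinate. *)
Lemma lebm_null_rows : lebm m.+1 A = 0%E <->
  {ae leb, forall t, lebm m [set u | A (consv t u)] = 0%E}.
Proof.
have mf := measurable_fun_xsection (lebm m) mA'.
have := (ae_eq_integral_abs leb measurableT mf).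
have -> : (\int[leb]_(t in setT) `|lebm m (xsection (@consp R m @^-1` A) t)|)%E =
   lebm m.+1 A.
  by apply: eq_integral => t _; rewrite gee0_abs.
move=> ->; split; apply: filterS; do ?exact: (ae_filter_ringOfSetsType leb).
  by move=> t /(_ I) /=; rewrite rowE.
by move=> t + _ /=; rewrite rowE.
Qed.

(** The companion of [lebm_null_rows] for the lines parallel to the first axis,
    which requires exchanging the order of integration. *)
Lemma lebm_null_cols : lebm m.+1 A = 0%E <->
  {ae (lebm m), forall u, leb [set t | A (consv t u)] = 0%E}.
Proof.
have mf := measurable_fun_ysection leb mA'.
have := (ae_eq_integral_abs (lebm m) measurableT mf).
have -> : (\int[lebm m]_(u in setT) `|leb (ysection (@consp R m @^-1` A) u)|)%E =
   lebm m.+1 A.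
  transitivity ((leb \x^ lebm m)%E (@consp R m @^-1` A)).
    by apply: eq_integral => t _; rewrite gee0_abs.
  have := indic_fubini_tonelli leb (lebm m) mA'.
  rewrite indic_fubini_tonelli_FE// => rowcol; apply: etrans (esym rowcol).
  apply: eq_integral => u _.
  exact: (esym (congr1 (fun g => g u) (indic_fubini_tonelli_GE leb mA'))).
move=> ->; split; apply: filterS; do ?exact: (ae_filter_ringOfSetsType (lebm m)).
  by move=> t /(_ I) /=; rewrite colE.
by move=> t + _ /=; rewrite colE.
Qed.

End null_sections.

Lemma ae_leb_translate (s : R) (P : R -> Prop) :
  {ae leb, forall t, P t} -> {ae leb, forall t, P (s + t)}.
Proof.
have ms : measurable_fun setT (fun t : measurableTypeR R => s + t : measurableTypeR R).
  exact: measurable_funD.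
have lebs (A : set (measurableTypeR R)) : measurable A ->
    leb A = leb [set t | A (s + t)].
  move=> mA.
  apply: (@lebesgue_stieltjes_measure_unique R _
    (measure_function_pushforward__canonical__measure_function_Measure leb ms)
    _ A mA).
  move=> X /ocitvP[->|[[a b]/= ab ->]]; first by rewrite !measure0.
  rewrite [LHS]lebesgue_measure_itv/= /pushforward.
  rewrite (_ : _ @^-1` _ = `](a - s), (b - s)]%classic); last first.
    by apply/seteqP; split => t /=; rewrite !in_itv/=; lra.
  rewrite lebesgue_measure_itv/= !lte_fin ab ltrD2r ab -!EFinB; congr EFin.
  ring.
move=> [A [mA A0 PA]]; exists [set t | A (s + t)]; split.
- by rewrite -[[set _ | _]]setTI; exact: ms.
- by rewrite -lebs.
- by move=> t /=; exact: PA.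
Qed.

Lemma measurable_translate n (B : set (borel_rV R n)) (b : 'rV[R]_n) : measurable B ->
  measurable ([set v | B (b + v)] : set (borel_rV R n)).
Proof.
move=> mB; rewrite -[[set _ | _]]setTI.
apply: (@continuous_measurable_rV_rV R n n (fun v => b + v)) => //.
apply: rV_continuous => x e e0; exists e => // y yx.
by rewrite (_ : b + y - (b + x) = y - x)//; rewrite opprD addrACA subrr add0r.
Qed.

(** By induction on the dimension, slice by slice; only the translation
    invariance on the line is used. *)
Lemma lebm_null_translate n (A : set (borel_rV R n)) (a : 'rV[R]_n) :
  measurable A -> lebm n A = 0%E -> lebm n [set v | A (a + v)] = 0%E.
Proof.
elim: n A a => [|m IH] A a mA.
  suff -> : [set v | A (a + v)] = A by [].
  by apply/seteqP; split => v /=; rewrite (thinmx0 a) add0r.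
move=> /(lebm_null_rows mA) /(ae_leb_translate (a ord0 ord0)) rowA.
apply/lebm_null_rows; first exact: measurable_translate.
apply: filterS rowA; first exact: (ae_filter_ringOfSetsType leb).
move=> t /(IH _ (tailv a) (measurable_row mA _)) <-; congr (lebm m _).
by apply/seteqP; split => u /=; rewrite -consvD consvK.
Qed.

End lebesgue_rV_theory.

(** * Gradients *)

Section gradients.
Context {R : realType}.

Lemma dotpDl n (a b v : 'rV[R]_n) : dotp (a + b) v = dotp a v + dotp b v.
Proof. by rewrite -big_split/=; apply: eq_bigr => i _; rewrite mxE mulrDl. Qed.

Lemma dotpZl n (c : R) (a v : 'rV[R]_n) : dotp (c *: a) v = c * dotp a v.
Proof. by rewrite mulr_sumr; apply: eq_bigr => i _; rewrite mxE mulrA. Qed.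

Lemma dotpC n (a v : 'rV[R]_n) : dotp a v = dotp v a.
Proof. by apply: eq_bigr => i _; rewrite mulrC. Qed.

Lemma dotpDr n (v a b : 'rV[R]_n) : dotp v (a + b) = dotp v a + dotp v b.
Proof. by rewrite !(dotpC v) dotpDl. Qed.

Lemma dotpZr n (c : R) (v a : 'rV[R]_n) : dotp v (c *: a) = c * dotp v a.
Proof. by rewrite !(dotpC v) dotpZl. Qed.

Lemma dotpNl n (a v : 'rV[R]_n) : dotp (- a) v = - dotp a v.
Proof. by rewrite -scaleN1r dotpZl mulN1r. Qed.

Lemma dotpBl n (a b v : 'rV[R]_n) : dotp (a - b) v = dotp a v - dotp b v.
Proof. by rewrite dotpDl dotpNl. Qed.

Lemma dotp0l n (v : 'rV[R]_n) : dotp 0 v = 0.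
Proof. by rewrite -(scale0r 0) dotpZl mul0r. Qed.

Lemma dotp0r n (v : 'rV[R]_n) : dotp v 0 = 0.
Proof. by rewrite dotpC dotp0l. Qed.

Lemma dotp_delta n (v : 'rV[R]_n) i : dotp v (delta_mx ord0 i) = v ord0 i.
Proof.
rewrite /dotp (bigD1 i)//= mxE !eqxx mulr1 big1 ?addr0// => j ji.
by rewrite mxE eqxx (negbTE ji) mulr0.
Qed.

Lemma dotp_consv m s t (u v : 'rV[R]_m) : dotp (consv s u) (consv t v) = s * t + dotp u v.
Proof.
rewrite /dotp big_ord_recl !consv0; congr (_ + _).
by apply: eq_bigr => i _; rewrite !consvS.
Qed.

Lemma dotp_le n (a v : 'rV[R]_n) : `|dotp a v| <= n%:R * `|a| * `|v|.
Proof.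
rewrite (le_trans (ler_norm_sum _ _ _))//.
have -> : n%:R * `|a| * `|v| = \sum_(i < n) `|a| * `|v|.
  by rewrite sumr_const card_ord -mulrA mulr_natl.
apply: ler_sum => i _.
by rewrite normrM ler_pM// rV_norm_coord.
Qed.

Definition nearly_affine k (g : 'rV[R]_k -> R) (p : 'rV[R]_k) (e d : R) :=
  forall h, `|h| < d -> `|g h - g 0 - dotp p h| <= e * `|h|.

(** Differentiability at 0 of a function on R^k, free of the operator 'd: this form
    lends itself to functions such as h |-> f (y + consv 0 h), whose
    differentiability is that of f along a slice. *)
Definition is_gradient k (g : 'rV[R]_k -> R) (q : 'rV[R]_k) :=
  forall e, 0 < e -> exists2 d, 0 < d & nearly_affine g q e d.

Lemma dotp_is_linear n (q : 'rV[R]_n) : linear (fun h => dotp q h : R).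
Proof. by move=> a u v; rewrite dotpDr dotpZr. Qed.

Lemma dotp_continuous n (q : 'rV[R]_n) : continuous (fun h : 'rV[R]_n => dotp q h).
Proof.
move=> x A /nbhs_ballP[e /= e0 eA].
pose C := n%:R * `|q| + 1.
have C0 : 0 < C by rewrite ltr_wpDl// mulr_ge0.
apply/nbhs_ballP; exists (e / C); first by rewrite /= divr_gt0.
move=> y; rewrite -ball_normE/= => xy; apply: eA; rewrite -ball_normE/=.
rewrite -(scaleN1r y) in xy.
have -> : dotp q x - dotp q y = dotp q (x + -1 *: y) by rewrite dotpDr dotpZr mulN1r.
rewrite (le_lt_trans (dotp_le _ _))//.
rewrite ltr_pdivlMr// mulrC in xy; apply: le_lt_trans xy.
by rewrite ler_wpM2r// lerDl.
Qed.

Lemma is_gradient_diff n (f : 'rV[R]_n -> R) x q :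
  is_gradient (fun h => f (x + h)) q -> differentiable f x /\ grad f x = q.
Proof.
move=> gq.
pose L : {linear 'rV[R]_n -> R} := HB.pack (fun h => dotp q h : R)
  (GRing.isLinear.Build R _ _ _ _ (dotp_is_linear q)).
have cL : continuous L by exact: dotp_continuous.
have dfL : 'd f x = L :> ('rV[R]_n -> R) /\ differentiable f x.
  suff fL : (f \o shift x : 'rV[R]_n -> R^o) = cst (f x) + (L : 'rV[R]_n -> R^o) +o_ (0 : 'rV[R]_n) id.
    have dfL : 'd f x = L :> ('rV[R]_n -> R).
      exact: diff_unique.
    by split => //; apply/diff_locallyP; rewrite dfL; split.
  apply/eqaddoP => e e0; have [d d0 dP] := gq e e0.
  apply/nbhs_ballP; exists d => //= h; rewrite -ball_normE/= sub0r normrN => hd.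
  by have := dP h hd; rewrite addr0 !fctE/= opprD addrA (addrC h).
move: dfL => [dfL df].
split => //; apply/rV_eq => i; rewrite /grad asboolT// mxE dfL.
exact: dotp_delta.
Qed.

Lemma diff_is_gradient n (f : 'rV[R]_n -> R) x :
  differentiable f x -> is_gradient (fun h => f (x + h)) (grad f x).
Proof.
move=> df e e0; have /eqaddoP /(_ e e0) /nbhs_ballP[d /= d0 dP] := diff_locally df.
exists d => // h hd; have := dP h; rewrite -ball_normE/= sub0r normrN => /(_ hd).
rewrite !fctE/= opprD addrA (addrC h) addr0.
rewrite (_ : dotp (grad f x) h = 'd f x h)//.
rewrite [in RHS](row_sum_delta h) linear_sum; apply: eq_bigr => i _.
by rewrite linearZ /grad asboolT// mxE [RHS]mulrC.
Qed.

Lemma differentiable_gradP n (f : 'rV[R]_n -> R) x :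
  differentiable f x <-> exists q, is_gradient (fun h => f (x + h)) q.
Proof.
split=> [/diff_is_gradient ?|[q /is_gradient_diff[]//]].
by exists (grad f x).
Qed.

(** Rational approximations of the gradient, with radii 1/(i+1), make
    differentiability a property defined by countably many conditions. *)
Lemma is_gradient_rat k (g : 'rV[R]_k -> R) q : is_gradient g q -> forall e, 0 < e ->
  exists (p : 'rV[rat]_k) (i : nat), 
   (forall h, `|dotp (map_mx ratr p - q) h| <= e * `|h|) /\
   nearly_affine g (map_mx ratr p) e i.+1%:R^-1.
Proof.
move=> gq e e0; have [|d d0 dP] := gq (e / 2); first by lra.
have e1 : 0 < e / 2 / (k%:R + 1) by rewrite divr_gt0 ?ltr_wpDl//; lra.
have [p pq] := rV_rat_approx q e1; exists p.
have [i id] : exists i, i.+1%:R^-1 < d.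
  by have [i _ /(_ i (leqnn i))] := near_infty_natSinv_lt (PosNum d0); exists i.
have pqh h : `|dotp (map_mx ratr p - q) h| <= e / 2 * `|h|.
  rewrite (le_trans (dotp_le _ _))// ler_wpM2r//.
  have /ltW := pq; rewrite ler_pdivlMr ?ltr_wpDl// => ple; apply: le_trans ple.
  by rewrite [leLHS]mulrC distrC ler_wpM2l// lerDl.
exists i; split => h.
  by rewrite (le_trans (pqh h))// ler_wpM2r//; lra.
move=> /lt_trans/(_ id)/dP gh.
rewrite -(subrK q (map_mx ratr p)) dotpDl.
have -> : e * `|h| = e / 2 * `|h| + e / 2 * `|h| by lra.
have := ler_normB (g h - g 0 - dotp q h) (dotp (map_mx ratr p - q) h).
rewrite -addrA -opprD (addrC (dotp q h)) => /le_trans; apply.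
exact: lerD.
Qed.

(** The converse of [is_gradient_rat]: approximate gradients of precisions tending
    to 0 form a Cauchy sequence, as one sees by comparing two of them along the
    coordinate axes.  The i-th coordinate of its limit is obtained as the supremum
    of the lower bounds given by the approximations. *)
Lemma is_gradient_lim k (g : 'rV[R]_k -> R) :
  (forall j, exists p d, 0 < d /\ nearly_affine g p j.+1%:R^-1 d) ->
  exists q, is_gradient g q.
Proof.
move=> /choice[p pP].
have pjl j l i : `|p j ord0 i - p l ord0 i| <= j.+1%:R^-1 + l.+1%:R^-1.
  have [dj [dj0 jP]] := pP j; have [dl [dl0 lP]] := pP l.
  pose s := Num.min dj dl / 2.
  have s0 : 0 < s by rewrite divr_gt0// lt_min dj0.
  pose h : 'rV[R]_k := s *: delta_mx ord0 i.
  have hs : `|h| <= s.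
    apply: rV_norm_le => [|l']; first exact: ltW.
    rewrite !mxE normrM (gtr0_norm s0) ler_piMr ?(ltW s0)//.
    by case: (_ && _); rewrite ?normr1 ?normr0.
  have sm : s < Num.min dj dl by rewrite /s gtr_pMr ?invf_lt1 ?ltr1n// lt_min dj0.
  have := jP h; rewrite (le_lt_trans hs)/=; last first.
    by rewrite (lt_le_trans sm)// ge_min lexx.
  have := lP h; rewrite (le_lt_trans hs)/=; last first.
    by rewrite (lt_le_trans sm)// ge_min lexx orbT.
  move=> /(_ isT) lh /(_ isT) jh.
  have := ler_normB (g h - g 0 - dotp (p l) h) (g h - g 0 - dotp (p j) h).
  rewrite opprB addrA (addrC _ (dotp (p j) h)) [X in `|X|](_ : _ = dotp (p j) h - dotp (p l) h).
    have -> : dotp (p j) h - dotp (p l) h = s * (p j ord0 i - p l ord0 i).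
      by rewrite /h !dotpZr !dotp_delta mulrBr.
    rewrite normrM (gtr0_norm s0) => H.
    rewrite -(ler_pM2l s0) (le_trans H)// (le_trans (lerD lh jh))//.
    by rewrite -mulrDl [X in X * _]addrC mulrC ler_wpM2r// addr_ge0.
  ring.
(* an explicit limit: p j - 1/(j+1) stays below it and p j + 1/(j+1) above it
   *)
pose q : 'rV[R]_k := \row_i sup [set p j ord0 i - j.+1%:R^-1 | j in [set: nat]].
have qp j : `|q - p j| <= j.+1%:R^-1.
  apply: rV_norm_le => // i; rewrite !mxE.
  have ub : ubound [set p j ord0 i - j.+1%:R^-1 | j in [set: nat]] (p j ord0 i + j.+1%:R^-1).
    move=> _ [l _ <-]; have := le_trans (ler_norm _) (pjl l j i).
    by rewrite lerBlDl lerBlDr -addrA (addrC j.+1%:R^-1).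
  have s1 := @ub_le_sup R _ (ex_intro _ _ ub) _ (imageT (fun l => p l ord0 i - l.+1%:R^-1) j).
  have s2 := ge_sup (ex_intro _ _ (imageT (fun l => p l ord0 i - l.+1%:R^-1) j)) ub.
  rewrite ler_norml; apply/andP; split; last by rewrite lerBlDl.
  by rewrite lerBrDr addrC.
exists q => e e0.
have e1 : 0 < e / (k%:R + 1) by rewrite divr_gt0// ltr_wpDl.
have [j je] : exists j, j.+1%:R^-1 < e / (k%:R + 1).
  by have [i _ /(_ i (leqnn i))] := near_infty_natSinv_lt (PosNum e1); exists i.
have [d [d0 dP]] := pP j; exists d => // h /dP gh.
rewrite -(subrK (p j) q) dotpDl.
have := ler_normB (g h - g 0 - dotp (p j) h) (dotp (q - p j) h).
rewrite -addrA -opprD (addrC (dotp (p j) h)) => /le_trans; apply.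
move: je; rewrite ltr_pdivlMr ?ltr_wpDl// => /ltW je.
apply: le_trans (lerD gh (dotp_le _ _)) _; rewrite -mulrDl ler_wpM2r//.
apply: le_trans je; rewrite mulrDr mulr1 addrC lerD2r mulrC ler_wpM2r//.
Qed.

End gradients.

(** * Measurability of the set of points of differentiability *)

Section borel_differentiability.
Context {R : realType}.

Lemma continuous_shift n (f : 'rV[R]_n -> R) (a : 'rV[R]_n) :
  continuous f -> continuous (fun y : 'rV[R]_n => f (y + a)).
Proof.
move=> cf y; apply: (@continuous_comp _ _ _ (fun z : 'rV[R]_n => z + a) f).
  apply: rV_continuous => x e e0; exists e => // w wx.
  by rewrite opprD addrACA subrr addr0.
exact: cf.
Qed.

(** By [is_gradient_rat] and [is_gradient_lim] the set is a countable intersection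
    of countable unions of the sets of points where f o (y + J) is nearly affine
    with given data, which are closed.  With J = id this is the set of points of
    differentiability, and with J = consv 0 that of differentiability along the
    slice. *)
Lemma measurable_gradient_set n k (f : 'rV[R]_n -> R) (J : 'rV[R]_k -> 'rV[R]_n) :
  continuous f ->
  measurable ([set y | exists q, is_gradient (fun h => f (y + J h)) q]
              : set (borel_rV R n)).
Proof.
move=> cf.
pose C (e d : R) (p : 'rV[R]_k) :=
  [set y | nearly_affine (fun h => f (y + J h)) p e d].
have closedC e d p : closed (C e d p).
  rewrite (_ : C e d p = \bigcap_(h in [set h | `|h| < d])
      (fun y => `|f (y + J h) - f (y + J 0) - dotp p h|) @^-1`
      [set t | t <= e * `|h|]); last first.
    by apply/seteqP; split => y yC h; exact: yC.
  apply: closed_bigI => h _; apply: preimage_closed; last exact: closed_le.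
  have cs a := @continuous_shift _ f a cf.
  move=> y; pose G z := f (z + J h) - f (z + J 0) - dotp p h.
  have cG : {for y, continuous G}.
    exact: (@continuousB R R^o _ _ _ y
      (@continuousB R R^o _ _ _ y (cs (J h) y) (cs (J 0) y)) (@cst_continuous _ _ _ _)).
  move=> _; exact: (@continuous_comp _ R R G (fun z : R => `|z|) y cG (@norm_continuous R R^o _)).
rewrite (_ : [set y | _] = \bigcap_j \bigcup_(pi : 'rV[rat]_k * nat)
    C j.+1%:R^-1 pi.2.+1%:R^-1 (map_mx ratr pi.1)); last first.
  apply/seteqP; split => [y [q yq] j _|y yC].
    have [p [i [_ pi]]] := is_gradient_rat yq (ltac:(by rewrite invr_gt0) : 0 < j.+1%:R^-1 :> R).
    by exists (p, i).
  apply: is_gradient_lim => j; have [[p i] _ pi] := yC j I.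
  by exists (map_mx ratr p), i.+1%:R^-1; rewrite invr_gt0 ltr0n.
apply: bigcapT_measurable => j; apply: countable_bigcupT_measurable.
  exact: countableP.
by move=> [p i]; apply: closed_measurable_rV.
Qed.

Lemma measurable_differentiable n (f : 'rV[R]_n -> R) : continuous f ->
  measurable ([set y | differentiable f y] : set (borel_rV R n)).
Proof.
move=> cf; have := measurable_gradient_set id cf.
rewrite (_ : [set y | exists q, _] = [set y | differentiable f y])//.
by apply/seteqP; split => y /=; rewrite differentiable_gradP.
Qed.

End borel_differentiability.

(** * Distance to a set of real numbers *)

Section distance_to_a_set.
Context {R : realType}.
Implicit Types (T : set R) (s t : R).

Definition distT T s := inf [set `|s - t| | t in T].

Let lbT T s : has_lbound [set `|s - t| | t in T].
Proof. by exists 0 => _ [t _ <-]. Qed.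

Lemma distT_le T s t : T t -> distT T s <= `|s - t|.
Proof. by move=> Tt; apply: ge_inf => //; exists t. Qed.

Lemma distT_ge0 T s : 0 <= distT T s.
Proof.
have [->|/set0P[t Tt]] := eqVneq T set0; first by rewrite /distT image_set0 inf0.
apply: lb_le_inf; first by exists `|s - t|, t.
by move=> _ [r _ <-].
Qed.

Lemma distT_lip T s s' : `|distT T s - distT T s'| <= `|s - s'|.
Proof.
have [->|/set0P[t Tt]] := eqVneq T set0.
  by rewrite /distT !image_set0 inf0 subrr normr0.
wlog : s s' / distT T s' <= distT T s.
  by move=> W; have [/W//|/ltW/W] := leP (distT T s') (distT T s); rewrite distrC (distrC s').
move=> le; rewrite ger0_norm ?subr_ge0// lerBlDr -lerBlDl.
apply: lb_le_inf; first by exists `|s' - t|, t.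
move=> _ [r Tr <-]; rewrite lerBlDl (le_trans (distT_le s Tr))//.
by rewrite -(subrKA s') ler_normD.
Qed.

Lemma distT_near T s e : T !=set0 -> distT T s < e -> exists2 t, T t & `|s - t| < e.
Proof.
move=> [t Tt] /inf_lt[]; first by exists `|s - t|, t.
by move=> _ [r Tr <-] re; exists r.
Qed.

Lemma derivable_approx (g : R -> R) t : derivable g t 1 ->
  exists c, forall e, 0 < e -> exists2 d, 0 < d &
    forall s, `|s| < d -> `|g (t + s) - g t - c * s| <= e * `|s|.
Proof.
move=> /cvg_ex[c /= gc]; exists c => e e0.
move/cvgrPdist_le : gc => /(_ e e0) /nbhs_ballP[d /= d0 dP]; exists d => // s sd.
have [->|s0] := eqVneq s 0; first by rewrite addr0 mulr0 !subrr normr0 mulr0.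
have := dP s; rewrite /ball/= sub0r normrN => /(_ sd s0).
rewrite distrC -[X in X <= _ -> _](_ : `|g (t + s) - g t - c * s| / `|s| = _).
  by rewrite ler_pdivrMr ?normr_gt0.
rewrite -normfV -normrM mulrBl mulfK//; congr `|_ - _|.
by rewrite /GRing.scale /= mulr1 mulrC (addrC s).
Qed.

(** The distance to T is nonnegative and vanishes at t, so that its derivative at t
    can only be 0: the points of T are o(s)-dense around t. *)
Lemma distT_derivable T t : T t -> derivable (distT T) t 1 ->
  forall e, 0 < e -> exists2 d, 0 < d &
    forall s, `|s| < d -> s != 0 -> exists2 r, T r & `|t + s - r| < e * `|s|.
Proof.
move=> Tt /derivable_approx[c cP] e e0.
have d0 : distT T t = 0.
  apply/eqP; rewrite eq_le distT_ge0 andbT.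
  by have := distT_le t Tt; rewrite subrr normr0.
have [|d dd0 dP] := cP (e / 4); first by lra.
exists d => // s sd s0; apply: distT_near; first by exists t.
have n0 : 0 < `|s| by rewrite normr_gt0.
(* the increments s and -s give opposite bounds on c s, and distances are
   nonnegative *)
have := dP s sd; have := dP (- s); rewrite !normrN => /(_ sd).
rewrite d0 !subr0 !ler_norml mulrN => /andP[_ ub1] /andP[_ ub2].
have g0 := distT_ge0 T (t - s).
have : e * `|s| = e/4 * `|s| + e/4 * `|s| + e/2 * `|s| by lra.
have : 0 < e/2 * `|s| by rewrite mulr_gt0//; lra.
lra.
Qed.

End distance_to_a_set.

(** * Rademacher's theorem *)

Section rademacher.
Context {R : realType}.
Notation leb := (@lebesgue_measure R).

Definition ball_lipschitz n (f : 'rV[R]_n -> R) (x : 'rV[R]_n) (r K : R) :=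
  forall y z, `|y - x| < r -> `|z - x| < r -> `|f y - f z| <= K * `|y - z|.

(** The estimates below depend on the radius and on the constant. *)
Definition loclip n (f : 'rV[R]_n -> R) :=
  forall x, exists r K, [/\ 0 < r, 0 <= K & ball_lipschitz f x r K].

Lemma locally_lipschitz_loclip n (f : 'rV[R]_n -> R) :
  locally_lipschitz f -> loclip f.
Proof.
move=> lf x; have [U /nbhs_ballP[r /= r0 rU] [M [Mreal MP]]] := lf x.
exists r, (`|M| + 1); split => //.
move=> y z yx zx; have := MP (`|M| + 1); rewrite ltr_pwDr ?ler_norm// => /(_ isT).
move=> /(_ (y, z)); apply => /=; split; apply: rU; rewrite -ball_normE/= distrC//.
Qed.

Lemma loclip_continuous n (f : 'rV[R]_n -> R) : loclip f -> continuous f.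
Proof.
move=> lf x A /nbhs_ballP[e /= e0 eA]; have [r [K [r0 K0 fK]]] := lf x.
apply/nbhs_ballP; exists (Num.min r (e / (K + 1))).
  by rewrite /= lt_min r0 divr_gt0// ltr_wpDl.
move=> y; rewrite -ball_normE/= lt_min distrC => /andP[yr ye].
apply: eA; rewrite -ball_normE/= (le_lt_trans (fK _ _ _ yr))//.
  by rewrite subrr normr0.
move: ye; rewrite ltr_pdivlMr ?ltr_wpDl// distrC => ye; apply: le_lt_trans ye.
by rewrite mulrC ler_wpM2l// lerDl.
Qed.

Lemma loclip_row m (f : 'rV[R]_m.+1 -> R) t : loclip f -> loclip (fun u => f (consv t u)).
Proof.
move=> lf u; have [r [K [r0 K0 fK]]] := lf (consv t u); exists r, K; split => //.
have cE v w : `|consv t v - consv t w| = `|v - w|.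
  rewrite consvB subrr; apply/eqP; rewrite eq_le; apply/andP; split.
    apply: rV_norm_le => // i; case: (unliftP ord0 i) => [j ->|->].
      by rewrite consvS rV_norm_coord.
    by rewrite consv0 normr0.
  apply: rV_norm_le => // i.
  by have := rV_norm_coord (consv 0 (v - w)) (lift ord0 i); rewrite consvS.
by move=> y z yu zu; rewrite -cE; apply: fK; rewrite cE.
Qed.

Lemma consv_normr m s : `|consv s (0 : 'rV[R]_m)| <= `|s|.
Proof.
apply: rV_norm_le => // i; case: (unliftP ord0 i) => [j ->|->].
  by rewrite consvS mxE normr0.
by rewrite consv0.
Qed.

Let norm5 (a b c d e : R) :
  `|a + b + c + d + e| <= `|a| + `|b| + `|c| + `|d| + `|e|.
Proof.
by do 4 (apply: le_trans (ler_normD _ _) _; apply: lerD => //).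
Qed.

(** Partial differentials assemble into a differential at (t, u) if each of the
    sets T of slices that are nearly affine with given rational data has a
    distance function derivable at t.  To compare f (t + s, u + h) with its
    expected value, move by the Lipschitz condition to a slice t' in T with
    |t + s - t'| <= e |s|, use there that f (t', .) is nearly affine, and move back
    to (t + s, u), which is governed by the derivative in the first variable. *)
Lemma slice_gradient m (f : 'rV[R]_m.+1 -> R) t u r K p :
  0 < r -> 0 <= K -> ball_lipschitz f (consv t u) r K ->
  is_gradient (fun h => f (consv t (u + h))) p ->
  derivable (fun s => f (consv s u)) t 1 ->
  (forall (i : 'rV[rat]_m * nat * nat),
     derivable (distT [set s | nearly_affine (fun h => f (consv s (u + h)))
        (map_mx ratr i.1.1) i.1.2.+1%:R^-1 i.2.+1%:R^-1]) t 1) ->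
  exists q, is_gradient (fun h => f (consv t u + h)) q.
Proof.
move=> r0 K0 fK gp /derivable_approx[c cP] dT.
exists (consv c p) => e e0.
pose e1 := Num.min 1 (e / (2 * K + 3)).
have e10 : 0 < e1 by rewrite lt_min ltr01 divr_gt0//; lra.
have e11 : e1 <= 1 by rewrite ge_min lexx.
have e1e : (2 * K + 3) * e1 <= e.
  by rewrite mulrC -ler_pdivlMr ?ge_min ?lexx ?orbT//; lra.
have [j je] : exists j, j.+1%:R^-1 < e1.
  by have [j _ /(_ j (leqnn j))] := near_infty_natSinv_lt (PosNum e10); exists j.
have j0 : 0 < j.+1%:R^-1 :> R by rewrite invr_gt0.
have [P [i [Pp Pi]]] := is_gradient_rat gp j0.
have [d1 d10 dP1] := distT_derivable (t := t) Pi (dT (P, j, i)) e10.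
have [d2 d20 dP2] := cP e1 e10.
have i0 : 0 < i.+1%:R^-1 :> R by rewrite invr_gt0.
exists (Num.min (Num.min d1 d2) (Num.min i.+1%:R^-1 (r / 2))).
  by rewrite !lt_min d10 d20 i0 divr_gt0.
move=> w; rewrite -(consvK w); move: (w ord0 ord0) (tailv w) => s h {w}.
rewrite !lt_min !consv_norm_lt => /andP[/andP[/andP[s1 _] /andP[s2 _]] /andP[/andP[_ hi] /andP[sr hr]]].
rewrite addr0 consvD dotp_consv.
have sw : `|s| <= `|consv s h|.
  by have := rV_norm_coord (consv s h) ord0; rewrite consv0.
have hw : `|h| <= `|consv s h|.
  apply: rV_norm_le => // l.
  by have := rV_norm_coord (consv s h) (lift ord0 l); rewrite consvS.
have [t' Tt' tt'] : exists2 t', nearly_affine (fun h => f (consv t' (u + h)))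
    (map_mx ratr P) j.+1%:R^-1 i.+1%:R^-1 & `|t + s - t'| <= e1 * `|s|.
  have [->|s0] := eqVneq s 0; first by exists t => //; rewrite addr0 subrr normr0 mulr0.
  by have [t' ? /ltW ?] := dP1 s s1 s0; exists t'.
have t't : `|t' - t| < r.
  rewrite -(subrKA (t + s)) (le_lt_trans (ler_normD _ _))//.
  rewrite (distrC t') [t + s - t]addrAC subrr add0r.
  have : e1 * `|s| <= `|s| by rewrite ler_piMl.
  lra.
have near' s' h' : `|s'| < r -> `|h'| < r -> `|consv (t + s') (u + h') - consv t u| < r.
  move=> ? ?; rewrite consvB consv_norm_lt addrAC subrr add0r.
  by rewrite [u + _]addrC addrK; apply/andP.
have near2 h' : `|h'| < r -> `|consv t' (u + h') - consv t u| < r.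
  move=> ?; have := near' (t' - t) h' t't; rewrite subrKC; exact.
have sr' : `|s| < r by lra.
have hr' : `|h| < r by lra.
have b1 : `|f (consv (t + s) (u + h)) - f (consv t' (u + h))| <= K * (e1 * `|s|).
  rewrite (le_trans (fK _ _ (near' _ _ sr' hr') (near2 _ hr')))// ler_wpM2l//.
  by rewrite consvB subrr (le_trans (consv_normr _ _)).
have b3 : `|f (consv t' (u + 0)) - f (consv (t + s) (u + 0))| <= K * (e1 * `|s|).
  have z0 : `|0 : 'rV[R]_m| < r by rewrite normr0.
  rewrite (le_trans (fK _ _ (near2 _ z0) (near' _ _ sr' z0)))// ler_wpM2l//.
  by rewrite consvB subrr (le_trans (consv_normr _ _))// distrC.
have b2 := Tt' h hi.
have b4 := dP2 s s2.
have b5 := Pp h.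
(* to the slice t', along it, back to the slice t + s, along the first axis,
   and from P to p *)
rewrite [X in `|X|](_ : _ =
  (f (consv (t + s) (u + h)) - f (consv t' (u + h))) +
  (f (consv t' (u + h)) - f (consv t' (u + 0)) - dotp (map_mx ratr P) h) +
  (f (consv t' (u + 0)) - f (consv (t + s) (u + 0))) +
  (f (consv (t + s) u) - f (consv t u) - c * s) +
  dotp (map_mx ratr P - p) h); last by rewrite dotpBl addr0; ring.
set W := `|consv s h| in sw hw *; pose X := e1 * W.
have W0 : 0 <= W by exact: normr_ge0.
have X1 : e1 * `|s| <= X by rewrite ler_wpM2l// ltW.
have X2 : K * (e1 * `|s|) <= K * X by rewrite ler_wpM2l.
have X3 : j.+1%:R^-1 * `|h| <= X by apply: ler_pM => //; exact: ltW.
have X4 : 2 * (K * X) + 3 * X <= e * W.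
  by have := ler_wpM2r W0 e1e; rewrite /X; lra.
apply: le_trans X4; apply: le_trans (norm5 _ _ _ _ _) _.
apply: (@le_trans _ _ (K * X + X + K * X + X + X)); last by lra.
apply: lerD (le_trans b5 X3); apply: lerD (le_trans b4 X1).
apply: lerD (le_trans b3 X2); apply: lerD (le_trans b2 X3).
exact: le_trans b1 X2.
Qed.

Theorem rademacher n (f : 'rV[R]_n -> R) : loclip f ->
  lebm n (~` [set y | differentiable f y]) = 0%E.
Proof.
elim: n f => [|m IH] f lf.
  rewrite (_ : ~` _ = set0) ?measure0//; apply/seteqP; split => // y; apply.
  apply/differentiable_gradP; exists 0 => e e0; exists 1 => // h _.
  by rewrite (thinmx0 h) addr0 dotp0r !subrr normr0 mulr_ge0// ltW.
have cf := loclip_continuous lf.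
have mA : measurable (~` [set y | differentiable f y] : set (borel_rV R m.+1)).
  by apply: measurableC; exact: measurable_differentiable.
pose B : set (borel_rV R m.+1) :=
  ~` [set y | exists q, is_gradient (fun h => f (y + consv 0 h)) q].
have mB : measurable B by apply: measurableC; exact: measurable_gradient_set.
have rowE t u h : f (consv t u + consv 0 h) = f (consv t (u + h)).
  by rewrite consvD addr0.
have B0 : lebm m.+1 B = 0%E.
  apply/lebm_null_rows => //; apply: aeW => t.
  rewrite -(IH _ (loclip_row t lf)); congr (lebm m _).
  apply/seteqP; split => u /=; apply: contra_not.
    by move=> /differentiable_gradP[q gq]; exists q; under eq_fun do rewrite rowE.
  move=> [q gq]; apply/differentiable_gradP; exists q.
  by under eq_fun do rewrite -rowE.
apply/lebm_null_cols => //.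
have /(lebm_null_cols mB) := B0.
apply: filterS; first exact: (ae_filter_ringOfSetsType (lebm m)).
move=> u Bu.
apply: measure_negligible; first exact: measurable_col.
have aeB : {ae leb, forall t, ~ B (consv t u)}.
  exists [set t | B (consv t u)]; split => //; first exact: measurable_col.
  by move=> t /= /contrapT.
have aeg : {ae leb, forall t, derivable (fun s => f (consv s u)) t 1}.
  apply: ae_derivable_locally_lipschitz => t.
  have [r [K [r0 K0 fK]]] := lf (consv t u); exists r, K; split => // s s' st s't.
  have nn a b : `|a - b| < r -> `|consv a u - consv b u| < r.
    by move=> ab; rewrite consvB subrr (le_lt_trans (consv_normr _ _)).
  rewrite (le_trans (fK _ _ (nn _ _ st) (nn _ _ s't)))// ler_wpM2l//.
  by rewrite consvB subrr consv_normr.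
have aeT : {ae leb, forall t (i : 'rV[rat]_m * nat * nat),
     derivable (distT [set s | nearly_affine (fun h => f (consv s (u + h)))
        (map_mx ratr i.1.1) i.1.2.+1%:R^-1 i.2.+1%:R^-1]) t 1}.
  apply: ae_forall_countable => i; apply: (@ae_derivable_lipschitz _ _ 1) => s s'.
  by rewrite mul1r distT_lip.
suff : {ae leb, forall t, differentiable f (consv t u)} by [].
apply: filterS3 aeB aeg aeT; first exact: (ae_filter_ringOfSetsType leb).
move=> t /contrapT[q gq] gt Tt; apply/differentiable_gradP.
have [r [K [r0 K0 fK]]] := lf (consv t u).
apply: (slice_gradient r0 K0 fK _ gt Tt).
by under eq_fun do rewrite -rowE; exact: gq.
Qed.

End rademacher.

(** * Limits along ultrafilters *)

Section ultrafilter_limits.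
Context {R : realType} (U : set_system nat) {UU : UltraFilter U}.

(** A bounded sequence converges along every ultrafilter: this takes the place of
    the extraction of subsequences, and extracts simultaneously from uncountably
    many sequences, such as the values of measures on all Borel sets. *)
Lemma ultra_cvg (s : nat -> R) (M : R) : (forall k, `|s k| <= M) ->
  exists l : R, s @ U --> l.
Proof.
move=> sM.
have [|l [_ lU]] := @segment_compact R (- M) M (fmap s U) _.
  by apply: (@filterE _ U) => k; rewrite /= in_itv/=; have := sM k; rewrite ler_norml.
exists l; apply/cvgrPdist_lt => e e0.
have [//|UN] := in_ultra_setVsetC [set k | `|l - s k| < e] UU.
have Us : fmap s U (s @` (~` [set k | `|l - s k| < e])).
  by apply: (@filterS _ U _ _ _ _ UN) => k Nk; exists k.
have [r [[k /= Nk <-]]] := lU _ _ Us (nbhsx_ballx l e e0).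
by rewrite -ball_normE.
Qed.

Lemma ultra_unique (s : nat -> R) (a b : R) : s @ U --> a -> s @ U --> b -> a = b.
Proof.
move=> sa sb; apply/eqP; rewrite eq_le; apply/andP; split.
  by apply: (ler_cvg_to sa sb); apply: nearW.
by apply: (ler_cvg_to sb sa); apply: nearW.
Qed.

Lemma ultra_cvg_rV n (s : nat -> 'rV[R]_n) (M : R) : (forall k, `|s k| <= M) ->
  exists l, forall e, 0 < e -> U [set k | `|s k - l| < e].
Proof.
move=> sM.
have /choice[l lP] : forall i, exists l : R, (fun k => s k ord0 i) @ U --> l.
  by move=> i; apply: (@ultra_cvg _ M) => k; rewrite (le_trans (rV_norm_coord _ _)).
exists (\row_i l i) => e e0.
have : U [set k | forall i, `|l i - s k ord0 i| < e].
  have Ui : forall i, U [set k | `|l i - s k ord0 i| < e].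
    by move=> i; move/cvgrPdist_lt : (lP i); exact.
  by apply: filter_forall.
apply: filterS => k kP; apply: rV_norm_lt => // i.
by rewrite !mxE distrC; exact: kP.
Qed.

End ultrafilter_limits.

Lemma nat_ultrafilter : exists U : set_system nat,
  UltraFilter U /\ forall k, U [set j | (k <= j)%N].
Proof.
have [U [UU oU]] := @ultraFilterLemma nat \oo _.
by exists U; split => // k; apply: oU; exists k.
Qed.

(** * Bounds and measurability of the gradient *)

Section gradient_bounds.
Context {R : realType}.

(** Df(y).v is the limit of difference quotients, each bounded by K |v|. *)
Lemma gradient_bound n (f : 'rV[R]_n -> R) x r K v y :
  0 <= K -> ball_lipschitz f x r K -> `|y - x| < r ->
  `|dotp (grad f y) v| <= K * `|v|.
Proof.
move=> K0 fK yx.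
have [df|ndf] := pselect (differentiable f y); last first.
  by rewrite /grad asboolF// dotp0l normr0 mulr_ge0.
have gq := diff_is_gradient df; move: (grad f y) gq => q gq.
have [->|v0] := eqVneq v 0; first by rewrite dotp0r !normr0 mulr0.
have nv : 0 < `|v| by rewrite normr_gt0.
apply/ler_addgt0Pr => e e0.
have [d d0 dP] := gq (e / `|v|) (divr_gt0 e0 nv).
pose t := Num.min d (r - `|y - x|) / 2 / `|v|.
have t0 : 0 < t by rewrite !divr_gt0// lt_min d0 subr_gt0.
have ntv : `|t *: v| = Num.min d (r - `|y - x|) / 2.
  by rewrite normrZ (gtr0_norm t0) /t divfK// gt_eqF.
have mpos : 0 < Num.min d (r - `|y - x|) by rewrite lt_min d0 subr_gt0.
have tvd : `|t *: v| < d.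
  rewrite ntv (@lt_le_trans _ _ (Num.min d (r - `|y - x|)))//; first by lra.
  by rewrite ge_min lexx.
have tvr : `|t *: v| < r - `|y - x|.
  rewrite ntv (@lt_le_trans _ _ (Num.min d (r - `|y - x|)))//; first by lra.
  by rewrite ge_min lexx orbT.
have := dP _ tvd; rewrite addr0 dotpZr => H.
have fl : `|f (y + t *: v) - f y| <= K * `|t *: v|.
  have := fK (y + t *: v) y; rewrite [y + _ - y]addrC addKr; apply => //.
  by rewrite addrAC (le_lt_trans (ler_normD _ _))// -ltrBrDl.
rewrite -(ler_pM2l t0).
have -> : t * `|dotp q v| = `|t * dotp q v| by rewrite normrM (gtr0_norm t0).
have -> : t * (K * `|v| + e) = K * `|t *: v| + e / `|v| * `|t *: v|.
  rewrite normrZ (gtr0_norm t0) mulrDr; congr (_ + _); first by rewrite mulrCA.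
  by rewrite mulrCA divfK// gt_eqF.
have := lerD fl H; apply: le_trans.
rewrite [X in _ <= X + _]distrC [leRHS](_ : _ = `|f (y + t *: v) - f y| + `|f (y + t *: v) - f y - t * dotp q v|); last by rewrite distrC.
have := ler_normB (f (y + t *: v) - f y) (f (y + t *: v) - f y - t * dotp q v).
by rewrite opprB addrC subrK.
Qed.

Lemma grad_norm_bound n (f : 'rV[R]_n -> R) x r K y :
  0 <= K -> ball_lipschitz f x r K -> `|y - x| < r -> `|grad f y| <= K.
Proof.
move=> K0 fK yx; apply: rV_norm_le => // i.
rewrite -dotp_delta (le_trans (gradient_bound _ K0 fK yx))// ler_piMr//.
exact: norm_delta_le1.
Qed.

(** Compactness of balls: along an ultrafilter, points with unbounded gradients
    would converge to a point without local Lipschitz constant. *)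
Lemma grad_bounded n (f : 'rV[R]_n -> R) x r : loclip f ->
  exists M, forall y, `|y - x| < r -> `|grad f y| <= M.
Proof.
move=> lf; apply: contrapT => nb.
have /choice[y yP] : forall k : nat, exists y, `|y - x| < r /\ k%:R < `|grad f y|.
  move=> k; apply: contrapT => H; apply: nb; exists k%:R => y yx.
  by rewrite leNgt; apply/negP => ky; apply: H; exists y.
have [U [UU UP]] := nat_ultrafilter.
have [|l lP] := @ultra_cvg_rV R U UU n y (r + `|x|).
  move=> k; rewrite -(subrK x (y k)) (le_trans (ler_normD _ _))// lerD2r.
  by apply/ltW; case: (yP k).
have [d [K [d0 K0 fK]]] := lf l.
have /filter_ex[k [/= ykl kK]] :
    U ([set k | `|y k - l| < d] `&` [set k | (Num.bound K <= k)%N]).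
  by apply: filterI; [exact: lP|exact: UP].
have := grad_norm_bound K0 fK ykl; apply/negP; rewrite -ltNge.
apply: lt_trans (yP k).2; apply: (@lt_le_trans _ _ (Num.bound K)%:R).
  by apply: le_lt_trans (ltr_norm_bound K); exact: ler_norm.
by rewrite ler_nat.
Qed.

(** On the Borel set of points of differentiability, each partial derivative is a
    limit of difference quotients, which are continuous; elsewhere it is 0. *)
Lemma measurable_grad n (f : 'rV[R]_n -> R) i : loclip f ->
  measurable_fun [set: borel_rV R n] (fun y : borel_rV R n => grad f y ord0 i).
Proof.
move=> lf; have cf := loclip_continuous lf.
pose D : set (borel_rV R n) := [set y | differentiable f y].
have mD : measurable D by exact: measurable_differentiable.
pose g (k : nat) (y : borel_rV R n) : R := \1_D y *
  ((f (y + k.+1%:R^-1 *: delta_mx ord0 i) - f y) * k.+1%:R).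
apply: (@measurable_fun_cvg _ _ _ _ g).
  move=> k; apply: measurable_funM; first exact: measurable_indic.
  apply: measurable_funM; last exact: measurable_cst.
  apply: measurable_funB; apply: continuous_measurable_rV => //.
  exact: continuous_shift.
move=> y _; have [Dy|nDy] := pselect (differentiable f y); last first.
  rewrite /grad asboolF// mxE (_ : g ^~ y = cst 0); first exact: cvg_cst.
  by apply/funext => k; rewrite /g indicE memNset// mul0r.
apply/cvgrPdist_le => e e0.
have [d d0 dP] := diff_is_gradient Dy e0.
near=> k.
have k0 : 0 < k.+1%:R :> R by rewrite ltr0n.
rewrite /g indicE mem_set// mul1r.
pose h : 'rV[R]_n := k.+1%:R^-1 *: delta_mx ord0 i.
have hk : `|h| <= k.+1%:R^-1.
  apply: rV_norm_le => [|j]; first by rewrite invr_ge0.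
  rewrite !mxE eqxx normrM (ger0_norm (_ : 0 <= k.+1%:R^-1 :> R)) ?invr_ge0//.
  by rewrite ler_piMr ?invr_ge0//; case: (_ && _); rewrite ?normr1 ?normr0.
have hd : `|h| < d.
  by apply: le_lt_trans hk _; near: k; exact: (near_infty_natSinv_lt (PosNum d0)).
have := dP h hd; rewrite addr0 /h dotpZr dotp_delta => H.
have kn0 : k.+1%:R != 0 :> R by rewrite gt_eqF.
rewrite (_ : _ - _ = - ((f (y + k.+1%:R^-1 *: delta_mx ord0 i) - f y -
  k.+1%:R^-1 * grad f y ord0 i) * k.+1%:R)); last by field.
rewrite normrN normrM (gtr0_norm k0) -ler_pdivlMr//.
by rewrite (le_trans H)// ler_wpM2l// ltW.
Unshelve. all: by end_near. Qed.

End gradient_bounds.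

(** * Averages over cubes *)

Section averages.
Context {R : realType} (n : nat).
Notation leb := (@lebm R n).
Implicit Types (f : 'rV[R]_n -> R) (x y v w z : 'rV[R]_n) (r K rho : R).

Definition cube rho : set (borel_rV R n) := [set z : 'rV[R]_n | `|z| < rho].

Lemma measurable_cube rho : measurable (cube rho).
Proof.
apply: open_measurable_rV; apply: open_rV_norm => u /= ur.
exists (rho - `|u|) => [|w wu]; first by rewrite subr_gt0.
by rewrite /cube/= -(subrK u w) (le_lt_trans (ler_normD _ _))// -ltrBrDr.
Qed.
Hint Resolve measurable_cube : core.

Lemma integrable_cube rho (g : borel_rV R n -> R) M : 0 < rho ->
  measurable_fun setT g -> (forall z, `|z| < rho -> `|g z| <= M) ->
  leb.-integrable (cube rho) (EFin \o g).
Proof.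
move=> rho0 mg gM; have /andP[_ fin] := lebm_ball n rho0.
apply: measurable_bounded_integrable => //; first exact: measurable_funTS.
exists M; split => [|M' MM' z zD]; first exact: num_real.
by apply: le_trans (ltW MM'); exact: gM.
Qed.

Definition cube_mass rho := fine (leb (cube rho)).

Lemma cube_mass_gt0 rho : 0 < rho -> 0 < cube_mass rho.
Proof. by move=> /(lebm_ball n) ?; exact: fine_gt0. Qed.

Lemma measurable_shift (g : borel_rV R n -> R) w :
  measurable_fun setT g -> measurable_fun setT (fun z : borel_rV R n => g (z + w)).
Proof.
move=> mg; apply: (measurableT_comp mg); apply: continuous_measurable_rV_rV.
apply: rV_continuous => x e e0; exists e => // u ux.
by rewrite opprD addrACA subrr addr0.
Qed.

Definition cube_int rho (g : 'rV[R]_n -> R) w :=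
  Rintegral leb (cube rho) (fun z => g (z + w)).

Lemma gradient_dir_cvg (f : 'rV[R]_n -> R) y v (s : nat -> R) :
  differentiable f y -> (forall k, s k != 0) -> s @ \oo --> 0 ->
  (s k)^-1 * (f (y + s k *: v) - f y) @[k --> \oo] --> dotp (grad f y) v.
Proof.
move=> df sn0 s0; apply/cvgrPdist_le => e e0.
have v1 : 0 < `|v| + 1 by rewrite ltr_wpDl.
have [d d0 dP] := diff_is_gradient df (divr_gt0 e0 v1).
have dv : 0 < d / (`|v| + 1) by rewrite divr_gt0.
move/cvgrPdist_lt : s0 => /(_ _ dv); apply: filterS => k.
rewrite sub0r normrN ltr_pdivlMr// => skd.
have sv : `|s k *: v| < d.
  by rewrite normrZ (le_lt_trans _ skd)// ler_wpM2l// lerDl.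
have := dP _ sv; rewrite addr0 dotpZr normrZ => H.
rewrite (_ : _ - _ = - ((s k)^-1 * (f (y + s k *: v) - f y - s k * dotp (grad f y) v))); last first.
  by field; exact: sn0.
rewrite normrN normrM normfV ler_pdivrMl ?normr_gt0// (le_trans H)//.
rewrite mulrCA ler_wpM2l// mulrAC ler_pdivrMr// ler_wpM2l ?(ltW e0)//.
by rewrite lerDl.
Qed.

Section local.
Variables (f : 'rV[R]_n -> R) (x : 'rV[R]_n) (r K rho : R).
Hypotheses (lf : loclip f) (K0 : 0 <= K) (fK : ball_lipschitz f x r K).
Hypothesis rho0 : 0 < rho.

Let near_in w z : `|w - x| + rho < r -> `|z| < rho -> `|z + w - x| < r.
Proof.
move=> wx zr; rewrite -addrA (le_lt_trans (ler_normD _ _))//.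
by rewrite (lt_trans _ wx)// [ltLHS]addrC ltrD2l.
Qed.

Let mf : measurable_fun [set: borel_rV R n] (f : borel_rV R n -> R).
Proof. by apply: continuous_measurable_rV; exact: loclip_continuous. Qed.

Lemma integrable_shift w : `|w - x| + rho < r ->
  leb.-integrable (cube rho) (EFin \o (fun z => f (z + w))).
Proof.
move=> wx; apply: (@integrable_cube _ _ (`|f w| + K * rho)) => //.
  exact: (measurable_shift _ mf).
move=> z zr; rewrite -(subrKC (f w) (f (z + w))) (le_trans (ler_normD _ _))// lerD2l.
have wr : `|w - x| < r by rewrite (le_lt_trans _ wx)// lerDl ltW.
by rewrite (le_trans (fK (near_in wx zr) wr))// addrK ler_wpM2l// ltW.
Qed.

Lemma measurable_grad_dir v :
  measurable_fun setT (fun y : borel_rV R n => dotp (grad f y) v).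
Proof.
apply: measurable_sum => i; apply: measurable_funM; last exact: measurable_cst.
exact: measurable_grad.
Qed.

Lemma integrable_grad_shift w v : `|w - x| + rho < r ->
  leb.-integrable (cube rho) (EFin \o (fun z => dotp (grad f (z + w)) v)).
Proof.
move=> wx; apply: (@integrable_cube _ _ (K * `|v|)) => //.
  exact: (measurable_shift _ (measurable_grad_dir v)).
by move=> z zr; apply: gradient_bound (near_in wx zr).
Qed.

(** Differentiation under the integral sign: at almost every point of the cube the
    difference quotients converge, by Rademacher's theorem, and they are dominated
    by the Lipschitz constant. *)
Lemma cube_int_derive w v : `|w - x| + rho < r ->
  h^-1 * (cube_int rho f (w + h *: v) - cube_int rho f w) @[h --> (0 : R)^'] -->
  cube_int rho (fun y => dotp (grad f y) v) w.
Proof.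
move=> wx; apply/cvgr_dnbhsP => t [tn0 t0].
pose d := r - (`|w - x| + rho).
have d0 : 0 < d by rewrite subr_gt0.
have [N _ tN] : \forall k \near \oo, `|t k| * `|v| < d.
  have v1 : 0 < `|v| + 1 by rewrite ltr_wpDl.
  have e0 : 0 < d / (`|v| + 1) by rewrite divr_gt0.
  move/cvgrPdist_lt : t0 => /(_ _ e0); apply: filterS => k.
  rewrite sub0r normrN ltr_pdivlMr// => tk; apply: le_lt_trans tk.
  by rewrite ler_wpM2l// lerDl.
rewrite -(cvg_shiftn N)/=.
pose s k := t (k + N)%N.
have sn0 k : s k != 0 by exact: tn0.
have sd k : `|s k| * `|v| < d by apply: tN; rewrite /= leq_addl.
have s0 : s @ \oo --> 0 by rewrite (cvg_shiftn N t).
have wsx k : `|w + s k *: v - x| + rho < r.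
  rewrite addrAC (le_lt_trans (lerD (ler_normD _ _) (lexx _)))// addrAC.
  by rewrite -ltrBrDl normrZ; exact: sd.
have sr k : `|w + s k *: v - x| < r by rewrite (le_lt_trans _ (wsx k))// lerDl ltW.
pose g k z := (s k)^-1 * (f (z + (w + s k *: v)) - f (z + w)).
have mg k : measurable_fun (cube rho) (EFin \o g k).
  apply/measurable_EFinP; apply: measurable_funTS; apply: measurable_funM => //.
  by apply: measurable_funB; exact: (measurable_shift _ mf).
have mG : measurable_fun (cube rho) (EFin \o (fun z => dotp (grad f (z + w)) v)).
  apply/measurable_EFinP; apply: measurable_funTS.
  exact: (measurable_shift _ (measurable_grad_dir v)).
have aecvg : {ae leb, forall z, cube rho z ->
    (EFin \o g k) z @[k --> \oo] --> (dotp (grad f (z + w)) v)%:E}.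
  pose B : set (borel_rV R n) := ~` [set y | differentiable f y].
  have mB : measurable B.
    by apply: measurableC; apply: measurable_differentiable; exact: loclip_continuous.
  exists [set z | B (w + z)]; split; first exact: measurable_translate.
    by apply: lebm_null_translate => //; exact: rademacher.
  move=> z ncv /= dz; apply: ncv => /= zr.
  apply/cvg_EFin; first by apply: nearW.
  rewrite addrC in dz; rewrite /g /=; under eq_fun do rewrite addrA.
  exact: (gradient_dir_cvg dz sn0 s0).
have intK : leb.-integrable (cube rho) (EFin \o cst (K * `|v|)).
  by apply: (@integrable_cube _ _ (`|K * `|v| |)).
have dom : {ae leb, forall z k, cube rho z ->
    (`|(EFin \o g k) z| <= (EFin \o cst (K * `|v|)%R) z)%E}.
  apply: aeW => z k zr; rewrite /= lee_fin normrM normfV ler_pdivrMl ?normr_gt0//.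
  rewrite (le_trans (fK (near_in (wsx k) zr) (near_in wx zr)))//.
  rewrite opprD addrACA subrr add0r addrAC subrr add0r normrZ.
  by rewrite mulrCA.
have [_ _ cvgI] := dominated_convergence (measurable_cube rho) mg mG aecvg intK dom.
rewrite /cube_int /Rintegral.
have intG := integrable_grad_shift v wx.
rewrite -(fineK (integrable_fin_num (measurable_cube rho) intG)) in cvgI.
move/fine_cvg : cvgI; apply: cvg_trans; apply: near_eq_cvg; apply: nearW => k /=.
rewrite -[LHS]/(Rintegral _ _ _) RintegralZl// -/(s k).
  by rewrite RintegralB//; exact: integrable_shift.
rewrite (_ : _ \o _ = (EFin \o (fun z => f (z + (w + s k *: v)))) \-
  (EFin \o (fun z => f (z + w))))%E//.
by apply: integrableB => //; exact: integrable_shift.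
Qed.

Lemma cube_int_mvt y v (t : R) : 0 < t ->
  (forall s, 0 <= s <= t -> `|y + s *: v - x| + rho < r) ->
  exists2 s, 0 <= s <= t & cube_int rho f (y + t *: v) - cube_int rho f y =
    cube_int rho (fun z => dotp (grad f z) v) (y + s *: v) * t.
Proof.
move=> t0 seg.
pose F s := cube_int rho f (y + s *: v).
have dF s : 0 <= s <= t ->
    is_derive s 1 F (cube_int rho (fun z => dotp (grad f z) v) (y + s *: v)).
  move=> st; have H := @cube_int_derive _ v (seg s st).
  have H' : h^-1 *: (F (h *: 1 + s) - F s) @[h --> (0 : R)^'] -->
      cube_int rho (fun z => dotp (grad f z) v) (y + s *: v).
    apply: cvg_trans H; apply: near_eq_cvg; apply: nearW => h.
    by rewrite /F [h *: 1]mulr1 scalerDl [_ *: v + _]addrC addrA.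
  apply: DeriveDef; first by apply/cvg_ex; eexists; exact: H'.
  by apply/cvg_lim => //; exact: H'.
have dFo s : s \in `]0, t[%R ->
    is_derive s 1 F (cube_int rho (fun z => dotp (grad f z) v) (y + s *: v)).
  by rewrite in_itv/= => /andP[s0 st]; apply: dF; rewrite !ltW.
have cF : {within `[0, t], continuous F}.
  apply: derivable_within_continuous => s; rewrite in_itv/= => /dF.
  by case.
have [s + sE] := MVT t0 dFo cF.
rewrite in_itv/= => /andP[s0 st]; exists s; first by rewrite !ltW.
by rewrite subr0 /F scale0r addr0 in sE.
Qed.

(** Some cube centred on the segment from y to y + t v has a mean of Df.v at least
    as large as the difference quotient of f, up to an error due to the size rho of
    the cube: averaging f over the cube changes f y and f (y + t v) by at most
    K rho each. *)
Lemma cube_int_slope y v (t : R) : 0 < t ->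
  (forall s, 0 <= s <= t -> `|y + s *: v - x| + rho < r) ->
  exists2 s, 0 <= s <= t &
    (f (y + t *: v) - f y - 2 * K * rho) * cube_mass rho <=
    cube_int rho (fun z => dotp (grad f z) v) (y + s *: v) * t.
Proof.
move=> t0 seg; have [s st sE] := cube_int_mvt t0 seg; exists s => //; rewrite -sE.
have tt : 0 <= t <= t by lra.
have t00 : (0 : R) <= 0 <= t by lra.
have ty := seg t tt; have yy := seg 0 t00; rewrite scale0r addr0 in yy.
rewrite /cube_int -RintegralB//; [|exact: integrable_shift..].
rewrite -Rintegral_cst//; apply: le_Rintegral => //.
- by apply: (@integrable_cube _ _ `|f (y + t *: v) - f y - 2 * K * rho|).
- rewrite (_ : _ \o _ = (EFin \o (fun z => f (z + (y + t *: v)))) \-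
    (EFin \o (fun z => f (z + y))))%E//.
  by apply: integrableB => //; exact: integrable_shift.
move=> z zr.
have cl w : `|w - x| + rho < r -> `|f (z + w) - f w| <= K * rho.
  move=> wx; have wr : `|w - x| < r by rewrite (le_lt_trans _ wx)// lerDl ltW.
  rewrite (le_trans (fK (near_in wx zr) wr))// addrK ler_wpM2l// ltW//.
have := cl _ ty; have := cl _ yy; rewrite !ler_norml; lra.
Qed.

End local.

End averages.

(** * Integration against a finitely additive measure *)

Section content_integration.
Context d (T : measurableType d) (R : realType).
Variable mu : {content set T -> \bar R}.
Hypothesis muT : mu setT = 1%E.

Definition mass (A : set T) : R := fine (mu A).

Lemma content_le1 A : measurable A -> (mu A <= 1)%E.
Proof. by move=> mA; rewrite -muT; apply: le_measure => //; exact/mem_set. Qed.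

Lemma massE A : measurable A -> mu A = (mass A)%:E.
Proof.
move=> mA; rewrite fineK// ge0_fin_numE ?measure_ge0//.
by rewrite (le_lt_trans (content_le1 mA))// ltry.
Qed.

Lemma mass_ge0 A : 0 <= mass A.
Proof. by rewrite fine_ge0// measure_ge0. Qed.

Lemma full_compl B : measurable B -> mu B = 1%E -> mu (~` B) = 0%E.
Proof.
move=> mB B1; have mCB := measurableC mB.
have := muT; rewrite -(setUv B) measureU ?setICr// B1 (massE mCB) -EFinD => -[].
by move=> H; congr EFin; lra.
Qed.

Lemma full_null B A : measurable B -> measurable A -> mu B = 1%E ->
  A `&` B = set0 -> mu A = 0%E.
Proof.
move=> mB mA B1 AB; apply/eqP; rewrite -measure_le0 -(full_compl mB B1).
apply: le_measure; [exact: mem_set|exact/mem_set/measurableC|].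
by move=> y Ay By; rewrite -[False]/(set0 y) -AB.
Qed.

Lemma full_setI B A : measurable B -> measurable A -> mu B = 1%E ->
  mu (B `&` A) = mu A.
Proof.
move=> mB mA B1.
have mAB : measurable (B `&` A) by exact: measurableI.
have mAD : measurable (A `\` B) by exact: measurableD.
have AE : A = (B `&` A) `|` (A `\` B).
  apply/seteqP; split => [y Ay|y [[]|[]]//].
  by have [By|nBy] := pselect (B y); [left|right].
rewrite [in RHS]AE measureU//.
  by rewrite (full_null mB mAD B1) ?adde0// setDKI.
by apply/seteqP; split => // y [[By _] [_]].
Qed.

Lemma sintegral_full B (s : {sfun T >-> R}) : measurable B -> mu B = 1%E ->
  sintegral (fun A => mu (B `&` A)) s = sintegral mu s.
Proof.
by move=> mB B1; apply: eq_fsbigr => a _; rewrite full_setI.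
Qed.

Lemma fibers_sum (C : choiceType) (p : T -> C) (D : set C) :
  finite_set (range p) -> (forall c, measurable (p @^-1` [set c])) ->
  mass (p @^-1` D) = \sum_(c <- fset_set (range p) | c \in D) mass (p @^-1` [set c]).
Proof.
move=> fp mp.
have fpD : finite_set (range p `&` D) by exact: finite_setIl.
have -> : p @^-1` D = \bigcup_(c in range p `&` D) p @^-1` [set c].
  apply/seteqP; split => [y Dy|y [c [_ Dc] /= ->]//].
  by exists (p y) => //; split => //; exists y.
rewrite /mass measure_fin_bigcup//; last exact: trivIset_preimage1.
rewrite fsbig_mkcondr fsbig_finite//=.
under eq_bigr => c _.
  rewrite (_ : (if _ then _ else _) =
    (if c \in D then mass (p @^-1` [set c]) else 0)%:E); last first.
    by case: ifP; rewrite ?massE.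
  over.
by rewrite sumEFin/= -big_mkcond.
Qed.

(** The integral of a function of p may be computed on the fibers of p.  With p
    the pair of two simple functions, this replaces the usual refinement of
    partitions in the proof of additivity, see [sint_linear]. *)
Lemma sintegral_fibers (C : choiceType) (p : T -> C) (phi : C -> R) (s : T -> R) :
  finite_set (range p) -> (forall c, measurable (p @^-1` [set c])) ->
  (forall y, s y = phi (p y)) ->
  sintegral mu s =
    (\sum_(c <- fset_set (range p)) phi c * mass (p @^-1` [set c]))%:E.
Proof.
move=> fp mp sE.
have fs : finite_set (range s).
  have -> : range s = phi @` range p.
    apply/seteqP; split => [_ [y _ <-]|_ [_ [y _ <-] <-]].
      by exists (p y); [exists y|rewrite sE].
    by exists y; rewrite ?sE.
  exact: finite_image.
have sfib a : s @^-1` [set a] = p @^-1` [set c | phi c = a].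
  by apply/seteqP; split => y /=; rewrite sE.
have ms a : measurable (s @^-1` [set a]).
  rewrite sfib (_ : _ @^-1` _ =
      \bigcup_(c in range p `&` [set c | phi c = a]) p @^-1` [set c]).
    by apply: fin_bigcup_measurable => //; exact: finite_setIl.
  apply/seteqP; split => [y Dy|y [c [_ Dc] /= ->]//].
  by exists (p y) => //; split => //; exists y.
rewrite /sintegral -(fsbig_widen (range s) setT)//=; last first.
  move=> a [_ Na] /=; rewrite (_ : s @^-1` [set a] = set0) ?measure0 ?mule0//.
  by apply/seteqP; split => // y /= sa; apply: Na; exists y.
rewrite fsbig_finite//.
under eq_bigr do rewrite massE// -EFinM.
rewrite sumEFin; congr EFin.
transitivity (\sum_(a <- fset_set (range s)) \sum_(c <- fset_set (range p))
    (if phi c == a then phi c * mass (p @^-1` [set c]) else 0)).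
  apply: eq_bigr => a _; rewrite sfib fibers_sum// mulr_sumr [LHS]big_mkcond/=.
  apply: eq_bigr => c _; rewrite (_ : (c \in _) = (phi c == a)).
    by case: eqP => // ->.
  by apply/idP/eqP => [/set_mem//|?]; exact/mem_set.
rewrite exchange_big/=; apply: eq_big_seq => c; rewrite in_fset_set// inE => -[y _ yc].
rewrite (bigD1_seq (phi c))/= ?fset_uniq ?in_fset_set//; last first.
  by rewrite inE; exists y; rewrite // sE yc.
rewrite eqxx big1 ?addr0// => a /negbTE.
by rewrite eq_sym => ->.
Qed.

(** The elementary integral as a real number: for a content of total mass 1 it is
    finite, see [sintE]. *)
Definition sint (s : T -> R) : R := fine (sintegral mu s).

Lemma sintE (s : {sfun T >-> R}) : sintegral mu s = (sint s)%:E.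
Proof.
by rewrite /sint (@sintegral_fibers _ (s : T -> R) id s)// => c; exact: measurable_funPTI.
Qed.

Lemma sfun_fibers (s : {sfun T >-> R}) :
  sint s = \sum_(a <- fset_set (range s)) a * mass (s @^-1` [set a]).
Proof.
by rewrite /sint (@sintegral_fibers _ (s : T -> R) id s)// => c; exact: measurable_funPTI.
Qed.

Lemma sint_linear c (s t : {sfun T >-> R}) :
  sint (fun y => c * s y + t y) = c * sint s + sint t.
Proof.
pose p y := (s y, t y).
have fp : finite_set (range p).
  apply: (@sub_finite_set _ _ (range s `*` range t)).
    by move=> _ [y _ <-]; split; exists y.
  exact: finite_setX.
have mp cc : measurable (p @^-1` [set cc]).
  rewrite (_ : _ @^-1` _ = s @^-1` [set cc.1] `&` t @^-1` [set cc.2]).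
    by apply: measurableI.
  apply/seteqP; split => y; rewrite /p /=; first by move=> <-.
  by case: cc => a b /= [-> ->].
rewrite /sint (sintegral_fibers (phi := fun q => c * q.1 + q.2) fp mp)//.
rewrite (sintegral_fibers (phi := fun q => q.1) fp mp)//.
rewrite (sintegral_fibers (phi := fun q => q.2) fp mp)//=.
rewrite mulr_sumr -big_split/=; apply: eq_bigr => q _.
by rewrite mulrDl mulrA.
Qed.

Lemma sint_le (s : {sfun T >-> R}) G M : measurable G -> mu G = 1%E ->
  (forall y, G y -> s y <= M) -> sint s <= M.
Proof.
move=> mG G1 sM; rewrite sfun_fibers.
have := @fibers_sum _ (s : T -> R) setT _ _; rewrite preimage_setT.
rewrite {1}/mass muT/= => mass1.
rewrite -[leRHS]mulr1 mass1//.
  rewrite mulr_sumr big_mkcond/= [leRHS]big_mkcond/=.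
  apply: ler_sum => a _; rewrite in_setT.
  have [aM|Ma] := leP a M; first by rewrite ler_wpM2r// mass_ge0.
  rewrite /mass (full_null mG _ G1) ?mulr0//.
  apply/seteqP; split => // y [/= sa Gy].
  by have := sM y Gy; rewrite sa leNgt Ma.
Qed.

Lemma sint_dist (s t : {sfun T >-> R}) G e : measurable G -> mu G = 1%E ->
  (forall y, G y -> `|s y - t y| <= e) -> `|sint s - sint t| <= e.
Proof.
move=> mG G1 ste.
have sub (u v : {sfun T >-> R}) : sint (v - u)%R = sint v - sint u.
  rewrite (_ : sint v - _ = -1 * sint u + sint v); last by lra.
  rewrite -sint_linear; congr sint; apply/funext => y.
  by rewrite sfunB/=; lra.
rewrite ler_norml; apply/andP; split.
  rewrite lerNl opprB -sub; apply: (sint_le mG G1) => y Gy.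
  by have := ste y Gy; rewrite sfunB/= distrC; apply: le_trans; exact: ler_norm.
rewrite -sub; apply: (sint_le mG G1) => y Gy.
by have := ste y Gy; rewrite sfunB/=; apply: le_trans; exact: ler_norm.
Qed.

Lemma sint_cst (c : R) : sint (@cst_sfun _ T R c) = c.
Proof.
apply/eqP; rewrite eq_le; apply/andP; split.
  by apply: (sint_le measurableT muT).
have := @sint_le (@cst_sfun _ T R (- c)) setT (- c) measurableT muT.
move=> /(_ (fun _ _ => lexx _)).
have -> : sint (@cst_sfun _ T R (- c)) = - sint (@cst_sfun _ T R c).
  have := sint_linear (-2) (@cst_sfun _ T R c) (@cst_sfun _ T R c).
  rewrite (_ : (fun y : T => _) = @cst_sfun _ T R (- c)); first by move=> ->; lra.
  by apply/funext => y; rewrite !cst_sfunE /=; lra.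
by rewrite lerN2.
Qed.

Lemma sint_comb n (v : 'I_n -> R) (s : 'I_n -> {sfun T >-> R}) :
  exists2 S : {sfun T >-> R}, forall y, S y = \sum_i v i * s i y &
    sint S = \sum_i v i * sint (s i).
Proof.
elim: (index_enum 'I_n) => [|i r [S SE sS]].
  by exists (@cst_sfun _ T R 0) => [y|]; rewrite big_nil ?sint_cst.
exists (@cst_sfun _ T R (v i) * s i + S) => [y|].
  by rewrite big_cons -SE.
by rewrite big_cons -sS -sint_linear.
Qed.

(** The integral of g over a set B of full measure, in terms of e-approximations
    instead of sequences of simple functions.  It is equivalent to [fa_integral],
    see [fa_integral_approx]. *)
Definition sint_approx (B : set T) (g : T -> R) (c : R) :=
  forall e, 0 < e -> exists2 s : {sfun T >-> R},
    (forall y, B y -> `|s y - g y| <= e) & `|sint s - c| <= e.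

(** Two sets of full measure have an intersection of full measure, so that neither
    the set nor the approximations influence the value of the integral. *)
Lemma sint_approxE B B' (s : {sfun T >-> R}) (g : T -> R) c e :
  measurable B -> mu B = 1%E -> measurable B' -> mu B' = 1%E ->
  sint_approx B g c -> (forall y, B' y -> `|s y - g y| <= e) ->
  `|sint s - c| <= e.
Proof.
move=> mB B1 mB' B'1 gc se; apply/ler_addgt0Pr => e' e'0.
have [|t tg tc] := gc (e' / 2); first by lra.
have BB : mu (B `&` B') = 1%E by rewrite full_setI.
have := @sint_dist s t (B `&` B') (e + e' / 2) (measurableI _ _ mB mB') BB.
move=> H; have {}H : `|sint s - sint t| <= e + e' / 2.
  apply: H => y [By B'y]; rewrite -(subrKA (g y)) (le_trans (ler_normD _ _))//.
  by apply: lerD; [exact: se|rewrite distrC; exact: tg].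
rewrite -(subrKA (sint t)) (le_trans (ler_normD _ _))//; lra.
Qed.

Lemma sint_approx_le B G (g : T -> R) c M :
  measurable B -> mu B = 1%E -> measurable G -> mu G = 1%E -> sint_approx B g c ->
  (forall y, B y -> G y -> g y <= M) -> c <= M.
Proof.
move=> mB B1 mG G1 gc gM; apply/ler_addgt0Pr => e e0.
have [|s sg sc] := gc (e / 2); first by lra.
have BG : mu (B `&` G) = 1%E by rewrite full_setI.
have : sint s <= M + e / 2.
  apply: (sint_le (measurableI _ _ mB mG) BG) => y [By Gy].
  have := sg y By; rewrite ler_distl => /andP[_ /le_trans]; apply.
  by rewrite lerD2r gM.
move: sc; rewrite ler_distl; lra.
Qed.

End content_integration.

Section simple_approximation.
Context d (T : measurableType d) (R : realType).

(** A staircase of N steps of height e, built by adding one step at a time. *)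
Lemma uniform_sfun (g : T -> R) (B : set T) (M e : R) : 0 < e ->
  measurable_fun setT g -> (forall y, B y -> `|g y| <= M) ->
  exists s : {sfun T >-> R}, forall y, B y -> `|s y - g y| <= e.
Proof.
move=> e0 mg gM.
have stair N : exists s : {sfun T >-> R}, forall y,
    (- M + e * N%:R <= g y -> s y = - M + e * N%:R) /\
    (- M <= g y < - M + e * N%:R -> `|s y - g y| <= e).
  elim: N => [|N [s sP]].
    exists (@cst_sfun _ T R (- M)) => y; rewrite mulr0 addr0; split => //.
    by move=> /andP[? ?]; exfalso; lra.
  have mA : measurable [set y | - M + e * N.+1%:R <= g y].
    rewrite -[X in measurable X]setTI.
    exact: (measurable_fun_le (f := cst (- M + e * N.+1%:R))).
  exists (s + @cst_sfun _ T R e * @indic_sfun _ T R _ mA) => y.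
  rewrite [(s + _) y](_ : _ = s y + e * \1_[set y | - M + e * N.+1%:R <= g y] y)//.
  rewrite indicE; have [sP1 sP2] := sP y.
  have NS : e * N.+1%:R = e * N%:R + e :> R by rewrite -natr1 mulrDr mulr1.
  split.
    move=> gy; rewrite mem_set// mulr1 sP1; lra.
  move=> /andP[Mg gN]; rewrite memNset/=; last by apply/negP; rewrite -ltNge.
  rewrite mulr0 addr0; have [gN'|gN'] := leP (- M + e * N%:R) (g y).
    by rewrite sP1// ler_norml; lra.
  by apply: sP2; rewrite Mg.
have [N Nb] : exists N : nat, 2 * M < e * N%:R.
  exists (Num.bound (2 * M / e)); rewrite [ltRHS]mulrC -ltr_pdivrMr//.
  exact: ltr_bound.
have [s sP] := stair N; exists s => y By; apply: (sP y).2.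
have := gM y By; rewrite ler_norml; lra.
Qed.

End simple_approximation.

(** * Limits of finitely additive measures *)

Section finitely_additive_limits.
Context d (T : measurableType d) (R : realType).
Implicit Types (mu : {content set T -> \bar R}).

(** The integrals of simple functions that approach g uniformly form a Cauchy
    sequence. *)
Lemma sint_approx_exists mu B (g : T -> R) (M : R) : mu setT = 1%E ->
  measurable B -> mu B = 1%E -> measurable_fun setT g ->
  (forall y, B y -> `|g y| <= M) ->
  exists c, sint_approx mu B g c.
Proof.
move=> muT mB B1 mg gM.
have /choice[s sP] : forall k : nat, exists s : {sfun T >-> R},
    forall y, B y -> `|s y - g y| <= k.+1%:R^-1.
  by move=> k; apply: (uniform_sfun _ mg gM); rewrite invr_gt0.
have dst j k : `|sint mu (s j) - sint mu (s k)| <= j.+1%:R^-1 + k.+1%:R^-1.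
  apply: (sint_dist muT mB B1) => y By.
  rewrite -(subrKA (g y)) (le_trans (ler_normD _ _))// lerD ?sP//.
  by rewrite distrC sP.
(* the ultralimit stands for the limit of a Cauchy sequence *)
have [U [UU UP]] := nat_ultrafilter.
have [|c cU] := @ultra_cvg R U UU (fun k => sint mu (s k)) (`|sint mu (s 0%N)| + 2).
  move=> k; rewrite -(subrKC (sint mu (s 0%N)) (sint mu (s k))).
  rewrite (le_trans (ler_normD _ _))// lerD2l (le_trans (dst _ _))//.
  by rewrite invr1 (_ : 2 = 1 + 1 :> R)// lerD2r invf_le1 ?ltr0n// ler1n.
exists c => e e0.
have e2 : 0 < e / 2 by lra.
have [j je] : exists j, j.+1%:R^-1 < e / 2.
  by have [j _ /(_ j (leqnn j))] := near_infty_natSinv_lt (PosNum e2); exists j.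
have k1 i : 0 < i.+1%:R^-1 :> R by rewrite invr_gt0.
exists (s j) => [y By|].
  by rewrite (le_trans (sP j y By))// (le_trans (ltW je))// ler_pdivrMr// ler_peMr ?ler1n ?(ltW e0).
apply/ler_addgt0Pr => e' e'0; have [i ie] : exists i, i.+1%:R^-1 < e'.
  by have [i _ /(_ i (leqnn i))] := near_infty_natSinv_lt (PosNum e'0); exists i.
move/cvgrPdist_le : cU => /(_ _ e2) cU.
have /filter_ex[k [/= ck ik]] :
    U ([set k | `|c - sint mu (s k)| <= e / 2] `&` [set k | (i <= k)%N]).
  by apply: filterI => //; exact: UP.
have ki : k.+1%:R^-1 <= i.+1%:R^-1 :> R by rewrite lef_pV2 ?posrE ?ltr0n// ler_nat.
rewrite -(subrKA (sint mu (s k))) (le_trans (ler_normD _ _))// (distrC _ c).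
have := dst j k; have := k1 k; move: (k.+1%:R^-1) (j.+1%:R^-1) (i.+1%:R^-1) ki je ie ck.
by move=> a b0 c0; lra.
Qed.

Section ultralimit.
Variables (U : set_system nat) (UU : UltraFilter U).
Variable mu_ : nat -> {content set T -> \bar R}.
Hypothesis mu_T : forall k, mu_ k setT = 1%E.

Let lim_ex A : exists l : R, measurable A -> (fun k => mass (mu_ k) A) @ U --> l.
Proof.
have [mA|nA] := pselect (measurable A); last by exists 0.
have [|l lP] := @ultra_cvg R U UU (fun k => mass (mu_ k) A) 1; last by exists l.
move=> k; rewrite ger0_norm ?mass_ge0// -lee_fin -(massE (mu_T k) mA).
exact: content_le1.
Qed.

Definition ulim_mass A := if pselect (measurable A) then sval (cid (lim_ex A)) else 0.

Lemma ulim_massP A : measurable A -> (fun k => mass (mu_ k) A) @ U --> ulim_mass A.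
Proof. by move=> mA; rewrite /ulim_mass; case: pselect => // ?; by case: (cid _) => l /=; apply. Qed.

(** Finite additivity is an identity between finitely many values, hence it passes
    to setwise limits along an ultrafilter.  Countable additivity does not, which
    is why density measures appear. *)
Lemma ulim_content : exists mu : {content set T -> \bar R},
  mu setT = 1%E /\
  forall A, measurable A -> (fun k => mass (mu_ k) A) @ U --> mass mu A.
Proof.
have ge0 A : (0 <= (ulim_mass A)%:E)%E.
  rewrite lee_fin; have [mA|nA] := pselect (measurable A); last first.
    by rewrite /ulim_mass; case: pselect.
  apply: (cvgr_to_ge (ulim_massP mA)); apply: nearW => k.
  exact: mass_ge0.
have add : measure_function.semi_additive (fun A : set T => (ulim_mass A)%:E : \bar R).
  move=> F m mF tF mUF; rewrite sumEFin; congr EFin.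
  apply: (ultra_unique (ulim_massP mUF)).
  have -> : (fun k => mass (mu_ k) (\big[setU/set0]_(i < m) F i)) =
      (fun k => \sum_(i < m) mass (mu_ k) (F i)).
    apply/funext => k; rewrite {1}/mass measure_semi_additive//.
    by under eq_bigr do rewrite (massE (mu_T k) (mF _)); rewrite sumEFin.
  by apply: cvg_big => [|i _]; [exact: add_continuous|exact: ulim_massP].
pose mu : {content set T -> \bar R} := HB.pack (fun A => (ulim_mass A)%:E)
  (isContent.Build d T R (fun A => (ulim_mass A)%:E) ge0 add).
exists mu; split => [|A mA]; last exact: ulim_massP.
congr EFin; apply: (ultra_unique (ulim_massP measurableT)).
rewrite (_ : (fun k => _) = cst 1); first exact: cvg_cst.
by apply/funext => k; rewrite /mass mu_T.
Qed.

(** The elementary integral of a simple function involves finitely many values of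
    the measure. *)
Lemma sint_ulim (mu : {content set T -> \bar R}) (s : {sfun T >-> R}) :
  mu setT = 1%E ->
  (forall A, measurable A -> (fun k => mass (mu_ k) A) @ U --> mass mu A) ->
  (fun k => sint (mu_ k) s) @ U --> sint mu s.
Proof.
move=> muT muP; rewrite (sfun_fibers muT).
under eq_fun do rewrite sfun_fibers//.
apply: cvg_big => [|a _]; first exact: add_continuous.
apply: cvgM; first exact: cvg_cst.
by apply: muP; exact: measurable_funPTI.
Qed.

End ultralimit.
End finitely_additive_limits.

Section fa_integral_approximation.
Context {R : realType} (n : nat).
Variable mu : {content set (borel_rV R n) -> \bar R}.
Hypothesis muT : mu setT = 1%E.
Variable B : set (borel_rV R n).
Hypotheses (mB : measurable B) (B1 : mu B = 1%E).

Lemma fa_integral_approx g c : fa_integral mu B g c <-> sint_approx mu B g c.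
Proof.
have sE (s : {sfun (borel_rV R n) >-> R}) :
    sintegral (fun A => mu (B `&` A)) s = (sint mu s)%:E.
  by rewrite sintegral_full// sintE.
split => [[s [sg sc]] e e0|gc].
  have near1 : \forall k \near \oo, forall y, B y -> `|s k y - g y| <= e.
    apply: (sg [set h : borel_rV R n -> R | forall y, B y -> `|h y - g y| <= e]).
    apply/uniform_nbhs; exists [set xy : R * R | ball xy.1 e xy.2].
    split; first exact: entourage_ball (PosNum e0).
    move=> h /= hP y By; have := hP y By; rewrite /ball/= distrC; exact: ltW.
  have near2 : \forall k \near \oo, `|sint mu (s k) - c| <= e.
    have : (fun k => (sint mu (s k))%:E) @ \oo --> c%:E.
      by apply: cvg_trans sc; apply: near_eq_cvg; apply: nearW => k; rewrite sE.
    move=> /fine_cvg /cvgrPdist_le /(_ e e0); apply: filterS => k /=.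
    by rewrite distrC.
  have /filter_ex[k [/= ? ?]] := @filterI _ _ eventually_filter _ _ near1 near2.
  by exists (s k).
have /choice[s sP] : forall k : nat, exists s : {sfun (borel_rV R n) >-> R},
    (forall y, B y -> `|s y - g y| <= k.+1%:R^-1) /\ `|sint mu s - c| <= k.+1%:R^-1.
  move=> k; have [|s ? ?] := gc k.+1%:R^-1; first by rewrite invr_gt0.
  by exists s.
exists s; split.
  move=> P /uniform_nbhs[V [entV VP]].
  move: entV; rewrite -entourage_ballE => -[e /= e0 eV].
  near=> k; apply: VP => y By; apply: eV => /=.
  rewrite /ball/= distrC (le_lt_trans ((sP k).1 y By))//.
  by near: k; exact: (near_infty_natSinv_lt (PosNum e0)).
have : (fun k => (sint mu (s k))%:E) @ \oo --> c%:E.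
  apply/cvg_EFin; first exact: nearW.
  apply/cvgrPdist_le => e e0; near=> k.
  rewrite /= distrC (le_trans (sP k).2)// ltW//.
  by near: k; exact: (near_infty_natSinv_lt (PosNum e0)).
by apply: cvg_trans; apply: near_eq_cvg; apply: nearW => k; rewrite sE.
Unshelve. all: by end_near. Qed.

End fa_integral_approximation.

(** * Euclidean balls *)

Section euclidean_balls.
Context {R : realType} {n : nat}.
Implicit Types x v : 'rV[R]_n.

Lemma dotp_ge0 v : 0 <= dotp v v.
Proof. by apply: sumr_ge0 => i _; rewrite -expr2 sqr_ge0. Qed.

Lemma norm_le_enorm v : `|v| <= enorm v.
Proof.
apply: rV_norm_le => [|i]; first exact: sqrtr_ge0.
rewrite -sqrtr_sqr ler_wsqrtr// /dotp (bigD1 i)//= -expr2 lerDl.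
by apply: sumr_ge0 => j _; rewrite -expr2 sqr_ge0.
Qed.

Lemma enorm_le_norm v : enorm v <= (n%:R + 1) * `|v|.
Proof.
have n0 : 0 <= (n%:R + 1) * `|v| by rewrite mulr_ge0// addr_ge0.
rewrite -(ger0_norm n0) -sqrtr_sqr ler_wsqrtr//.
rewrite (le_trans (ler_norm _))// (le_trans (dotp_le _ _))//.
rewrite exprMn -mulrA expr2 (expr2 `|v|) ler_wpM2r//.
have : 0 <= n%:R :> R by []. 
move: (n%:R : R) => m m0; nra.
Qed.

Lemma measurable_eball x (delta : R) : measurable (eball x delta : set (borel_rV R n)).
Proof.
have mg : measurable_fun [set: borel_rV R n]
    (fun y : borel_rV R n => enorm (y - x)).
  apply: (measurableT_comp (continuous_measurable_fun (@sqrt_continuous R))).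
  have mc i : measurable_fun [set: borel_rV R n]
      (fun y : borel_rV R n => (y - x : 'rV[R]_n) ord0 i).
    under eq_fun do rewrite !mxE.
    apply: measurable_funB; last exact: measurable_cst.
    by apply: continuous_measurable_rV; exact: coord_continuous.
  by apply: measurable_sum => i; apply: measurable_funM; exact: mc.
rewrite (_ : eball x delta = (fun y => enorm (y - x)) @^-1` `]-oo, delta[%classic).
  by rewrite -[X in measurable X]setTI; exact: mg.
by apply/seteqP; split => y; rewrite /= in_itv.
Qed.

End euclidean_balls.

(** * Means of the gradient *)

Section gradient_means.
Context {R : realType} {n : nat}.
Notation E := (borel_rV R n).
Implicit Types (mu : {content set E -> \bar R}) (B G : set E).
Variable f : 'rV[R]_n -> R.

Definition grad_mean mu B (w : 'rV[R]_n) := forall i,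
  sint_approx mu B (fun y : E => grad f y ord0 i) (w ord0 i).

Lemma grad_mean_dir mu B w v : mu setT = 1%E -> grad_mean mu B w ->
  sint_approx mu B (fun y : E => dotp (grad f y) v) (dotp w v).
Proof.
move=> muT wP e e0.
pose C := \sum_i `|v ord0 i|.
have C0 : 0 <= C by apply: sumr_ge0.
have C1 : 0 < C + 1 by rewrite ltr_wpDl.
pose e' := e / (C + 1).
have e'0 : 0 < e' by rewrite divr_gt0.
have Ce : C * e' <= e.
  by rewrite /e' mulrA ler_pdivrMr// mulrC ler_wpM2l ?(ltW e0)// lerDl.
have /choice[s sP] : forall i, exists s : {sfun E >-> R},
    (forall y, B y -> `|s y - grad f y ord0 i| <= e') /\ `|sint mu s - w ord0 i| <= e'.
  by move=> i; have [s ? ?] := wP i e' e'0; exists s.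
have [S SE sS] := sint_comb muT (fun i => v ord0 i) s.
have comb (a : 'I_n -> R) (q : 'rV[R]_n) : (forall i, `|a i - q ord0 i| <= e') ->
    `|\sum_i v ord0 i * a i - dotp q v| <= e.
  move=> ab; apply: le_trans Ce; rewrite -sumrB (le_trans (ler_norm_sum _ _ _))//.
  rewrite mulr_suml; apply: ler_sum => i _.
  by rewrite [X in _ - X]mulrC -mulrBr normrM ler_wpM2l.
exists S => [y By|]; first by rewrite SE; apply: comb => i; exact: (sP i).1.
by rewrite sS; apply: comb => i; exact: (sP i).2.
Qed.

Lemma mean_le mu B G w v M : mu setT = 1%E -> measurable B -> mu B = 1%E ->
  measurable G -> mu G = 1%E -> grad_mean mu B w ->
  (forall y, B y -> G y -> dotp (grad f y) v <= M) -> dotp w v <= M.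
Proof.
move=> muT mB B1 mG G1 /(grad_mean_dir v muT) wP.
exact: (sint_approx_le muT mB B1 mG G1 wP).
Qed.

(** Test [mean_le] along the axes, in both directions. *)
Lemma grad_mean_norm_le mu B w x r (K : R) : mu setT = 1%E -> measurable B ->
  mu B = 1%E -> grad_mean mu B w -> 0 <= K -> ball_lipschitz f x r K ->
  (forall y, B y -> `|y - x| < r) -> `|w| <= K.
Proof.
move=> muT mB B1 wP K0 fK Bx; apply: rV_norm_le => // i; rewrite ler_norml.
have bnd (u : 'rV[R]_n) : `|u| <= 1 -> dotp w u <= K.
  move=> u1; apply: (mean_le muT mB B1 measurableT muT wP) => y /Bx yx _.
  rewrite (le_trans (ler_norm _))// (le_trans (gradient_bound _ K0 fK yx))//.
  by rewrite ler_piMr.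
rewrite -(dotp_delta w i) bnd ?norm_delta_le1// andbT lerNl -mulN1r -dotpZr.
by rewrite bnd// normrZ normrN1 mul1r norm_delta_le1.
Qed.

Hypothesis lf : loclip f.

(** Means w_k of Df with respect to contents concentrating at x converge to the
    mean of Df with respect to the limit content.  On a given ball, one simple
    function approximates Df uniformly; its integral converges, and for almost all k
    it differs from w_k by at most the precision of the approximation. *)
Lemma density_limit x (U : set_system nat) (UU : UltraFilter U)
    (mu_ : nat -> {content set E -> \bar R}) (B_ : nat -> set E)
    (w_ : nat -> 'rV[R]_n) w :
  (forall k, mu_ k setT = 1%E) ->
  (forall k A, measurable A -> lebesgue_rV A = 0%E -> mu_ k A = 0%E) ->
  (forall k, measurable (B_ k)) -> (forall k, mu_ k (B_ k) = 1%E) ->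
  (forall k, grad_mean (mu_ k) (B_ k) (w_ k)) ->
  (forall delta, 0 < delta -> U [set k | mu_ k (eball x delta) = 1%E]) ->
  (forall e, 0 < e -> U [set k | `|w_ k - w| < e]) ->
  density_integrals f x w.
Proof.
move=> mu_T mu_null mB B1 wP ballU wU.
have [mu [muT muP]] := ulim_content UU mu_T.
have ball1 delta : 0 < delta -> mu (eball x delta) = 1%E.
  move=> d0; rewrite (massE muT (measurable_eball x delta)); congr EFin.
  apply: (ultra_unique (muP _ (measurable_eball x delta))).
  apply/cvgrPdist_le => e e0; apply: filterS (ballU _ d0) => k /= kb.
  by rewrite /mass kb subrr normr0 ltW.
exists mu.
  split => // A mA A0; rewrite (massE muT mA); congr EFin.
  apply: (ultra_unique (muP _ mA)); rewrite (_ : (fun k => _) = cst 0).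
    exact: cvg_cst.
  by apply/funext => k; rewrite /mass mu_null.
move=> delta i d0; apply/fa_integral_approx; rewrite ?ball1//.
  exact: measurable_eball.
move=> e e0.
have [M gM] := grad_bounded x delta lf.
have [s sP] : exists s : {sfun E >-> R}, forall y, eball x delta y ->
    `|s y - grad f y ord0 i| <= e.
  apply: (@uniform_sfun _ E R _ _ M) => //; first exact: measurable_grad.
  move=> y yx; rewrite (le_trans (rV_norm_coord _ _))// gM//.
  exact: le_lt_trans (norm_le_enorm _) yx.
exists s => //; apply/ler_addgt0Pr => e' e'0.
have e2 : 0 < e' / 2 by lra.
have := @sint_ulim _ E R U UU mu_ mu_T mu s muT muP => /cvgrPdist_le /(_ _ e2) sU.
have /filter_ex[k [[/= k1 k2] k3]] : U (([set k | `|sint mu s - sint (mu_ k) s| <= e' / 2] `&`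
    [set k | mu_ k (eball x delta) = 1%E]) `&` [set k | `|w_ k - w| < e' / 2]).
  by apply: filterI; [apply: filterI => //; exact: ballU|exact: wU].
have := sint_approxE (mu_T k) (mB k) (B1 k) (measurable_eball x delta) k2 (wP k i) sP.
move=> k4; have k5 : `|w_ k ord0 i - w ord0 i| <= e' / 2.
  apply: le_trans (ltW k3); have := rV_norm_coord (w_ k - w) i.
  by rewrite mxE [X in _ + X]mxE.
rewrite -(subrKA (sint (mu_ k) s)) (le_trans (ler_normD _ _))//.
rewrite -[X in _ + `|X|](subrKA (w_ k ord0 i)).
have := ler_normD (sint (mu_ k) s - w_ k ord0 i) (w_ k ord0 i - w ord0 i).
lra.
Qed.

End gradient_means.

(** * Uniform measures on cubes *)

Section cube_contents.
Context {R : realType} {n : nat}.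
Notation E := (borel_rV R n).
Notation leb := (@lebm R n).
Implicit Types (x y v w : 'rV[R]_n).

Let shift w (z : E) : E := (z : 'rV[R]_n) + w.

Let measurable_shift_map w : measurable_fun setT (shift w).
Proof.
apply: continuous_measurable_rV_rV; apply: rV_continuous => x e e0; exists e => // u ux.
by rewrite /shift opprD addrACA subrr addr0.
Qed.

Let measurable_unshift w (A : set E) :
  measurable A -> measurable ([set z | A (z + w)] : set E).
Proof. by move=> mA; rewrite -[X in measurable X]setTI; exact: measurable_shift_map. Qed.

Section uniform_content.
Variables (rho : R) (w : 'rV[R]_n).
Hypothesis rho0 : 0 < rho.

Let c : {nonneg R} := NngNum (ltW (divr_gt0 ltr01 (cube_mass_gt0 n rho0))).

(** The uniform probability measure on the cube of radius rho centred at w; this is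
    a ball for the sup norm. *)
Definition cube_content : set E -> \bar R :=
  mscale c (measure_function_pushforward__canonical__measure_function_Measure
    (mrestr leb (@measurable_cube R n rho)) (measurable_shift_map w)).

HB.instance Definition _ := Measure.on cube_content.

Lemma cube_contentE A :
  cube_content A = ((cube_mass n rho)^-1%:E * leb ([set z : E | A ((z : 'rV[R]_n) + w)%R] `&` @cube R n rho))%E.
Proof. by rewrite /cube_content /mscale /= div1r. Qed.

Lemma cube_leb_fin : leb (@cube R n rho) = (cube_mass n rho)%:E.
Proof.
by rewrite /cube_mass fineK// ge0_fin_numE//; have /andP[] := lebm_ball n rho0.
Qed.

Lemma cube_contentT : cube_content setT = 1%E.
Proof.
rewrite cube_contentE (_ : [set z | _] = setT) ?setTI; last exact/seteqP.
by rewrite cube_leb_fin -EFinM mulVf// gt_eqF// cube_mass_gt0.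
Qed.

Lemma cube_content_ball : cube_content [set y : 'rV[R]_n | `|y - w| < rho] = 1%E.
Proof.
rewrite cube_contentE setIidr; last by move=> z zr; rewrite /= addrK.
by rewrite cube_leb_fin -EFinM mulVf// gt_eqF// cube_mass_gt0.
Qed.

Lemma cube_content_null (A : set E) : measurable A -> lebesgue_rV A = 0%E ->
  cube_content A = 0%E.
Proof.
move=> mA; rewrite -lebmE => A0; rewrite cube_contentE.
rewrite (_ : leb _ = 0%E) ?mule0//.
apply/eqP; rewrite -measure_le0 -(lebm_null_translate w mA A0).
apply: le_measure; rewrite ?inE//.
- by apply: measurableI; [exact: measurable_unshift|exact: measurable_cube].
- exact: measurable_translate.
- by move=> z [/= Az _]; rewrite addrC.
Qed.

Lemma leb_cube_fin (P : set E) : measurable P ->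
  leb (P `&` @cube R n rho) = (fine (leb (P `&` @cube R n rho)))%:E.
Proof.
move=> mP; rewrite fineK// ge0_fin_numE//; have /andP[_] := lebm_ball n rho0.
apply: le_lt_trans; apply: le_measure; rewrite ?inE//.
  by apply: measurableI => //; exact: measurable_cube.
exact: measurable_cube.
Qed.

Lemma integral_scaled_indic (a : R) (P : set E) : measurable P ->
  (\int[leb]_(z in cube rho) (a * \1_P z)%:E =
  (a * fine (leb (P `&` cube rho)))%:E)%E.
Proof.
move=> mP; rewrite EFinM -leb_cube_fin// -integral_indic//; last exact: measurable_cube.
rewrite -integralZl//; last first.
- apply: (@integrable_cube _ _ _ (\1_P) 1) => //.
  by move=> z _; rewrite indicE; case: (_ \in _); rewrite ?normr1 ?normr0.
- exact: measurable_cube.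
Qed.

(** The elementary integral against this measure is a Lebesgue average. *)
Lemma sint_cube_content (s : {sfun E >-> R}) :
  sint cube_content s = (cube_mass n rho)^-1 * cube_int rho s w.
Proof.
rewrite (sfun_fibers cube_contentT) /cube_int /Rintegral.
pose P a : set E := [set z | s (z + w) = a].
have mP a : measurable (P a).
  by apply: (measurable_unshift w (A := s @^-1` [set a])); exact: measurable_funPTI.
have intP a : leb.-integrable (@cube R n rho) (fun z => (a * \1_(P a) z)%:E).
  apply: (@integrable_cube _ _ _ (fun z => a * \1_(P a) z) `|a|) => //.
    by apply: measurable_funM; [exact: measurable_cst|exact: measurable_indic].
  move=> z _; rewrite normrM indicE ler_piMr//.
  by case: (_ \in _); rewrite ?normr1 ?normr0.
rewrite (eq_integral (fun z => \sum_(a <- fset_set (range s)) (a * \1_(P a) z)%:E)%E).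
  rewrite integral_sum//; last exact: measurable_cube.
  under [in RHS]eq_bigr => a _.
    rewrite (_ : (\int[leb]_(z in @cube R n rho) (a * \1_(P a) z)%:E)%E =
      (a * fine (leb (P a `&` @cube R n rho)))%:E); last first.
      exact: integral_scaled_indic.
    over.
  rewrite sumEFin/= mulr_sumr; apply: eq_bigr => a _.
  rewrite mulrCA; congr (_ * _).
  transitivity (fine (cube_content (s @^-1` [set a]))) => //.
  by rewrite cube_contentE (leb_cube_fin (mP a)).
move=> z _; rewrite sumEFin; congr EFin.
have zs : s (z + w) \in fset_set (range s).
  by rewrite in_fset_set// inE; exists (z + w).
rewrite (bigD1_seq (s (z + w))) ?fset_uniq//= indicE mem_set// mulr1 big1 ?addr0// => a az.
by rewrite indicE memNset ?mulr0// /P /= => sza; rewrite sza eqxx in az.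
Qed.

End uniform_content.

(** The Lebesgue average of Df over a cube as a finitely additive integral.  Its
    scalar product with v is bounded below through a simple function that is uniformly
    close to Df.v. *)
Lemma cube_mean (f : 'rV[R]_n -> R) x r K rho w v : loclip f -> 0 <= K ->
  ball_lipschitz f x r K -> 0 < rho -> `|w - x| + rho < r ->
  exists mu : {content set E -> \bar R}, exists w' : 'rV[R]_n,
  [/\ mu setT = 1%E,
      forall A : set E, measurable A -> lebesgue_rV A = 0%E -> mu A = 0%E,
      mu [set y : 'rV[R]_n | `|y - w| < rho] = 1%E,
      grad_mean f mu [set y : 'rV[R]_n | `|y - w| < rho] w' &
      `|w'| <= K /\ cube_int rho (fun z => dotp (grad f z) v) w <= cube_mass n rho * dotp w' v].
Proof.
move=> lf K0 fK rho0 wx.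
pose B : set E := [set y : 'rV[R]_n | `|y - w| < rho].
pose mu : {content set E -> \bar R} := cube_content w rho0.
have muT : mu setT = 1%E by exact: cube_contentT.
have B1 : mu B = 1%E by exact: cube_content_ball.
have mB : measurable B.
  rewrite (_ : B = [set y | cube rho (- w + y)]).
    by apply: measurable_translate; exact: measurable_cube.
  by apply/seteqP; split => y; rewrite /B /cube /= addrC.
have Bx y : B y -> `|y - x| < r.
  move=> yw; rewrite -(subrKA w) (le_lt_trans (ler_normD _ _))//.
  by rewrite (lt_trans _ wx)// [ltRHS]addrC ltrD2r.
have /choice[c cP] : forall i, exists c, sint_approx mu B (fun y : E => grad f y ord0 i) c.
  move=> i; apply: (@sint_approx_exists _ _ _ mu B _ K) => //; first exact: measurable_grad.
  by move=> y /Bx yx; rewrite (le_trans (rV_norm_coord _ _))// (grad_norm_bound K0 fK yx).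
pose w' : 'rV[R]_n := \row_i c i.
have w'P : grad_mean f mu B w' by move=> i; rewrite mxE; exact: cP.
exists mu, w'; split => //; first by move=> A mA; exact: cube_content_null.
split.
  exact: (grad_mean_norm_le muT mB B1 w'P K0 fK Bx).
have cm := cube_mass_gt0 n rho0.
apply/ler_addgt0Pr => e e0.
pose e' := e / (2 * cube_mass n rho).
have e'0 : 0 < e' by rewrite divr_gt0// mulr_gt0.
have [S Sg Sc] := grad_mean_dir v muT w'P e'0.
pose g y := dotp (grad f y) v.
have zB z : cube rho z -> B (z + w) by move=> zr; rewrite /B /= addrK.
have intg := integrable_grad_shift lf K0 fK rho0 v wx.
have intS : leb.-integrable (cube rho) (EFin \o (fun z => S (z + w))).
  apply: (@integrable_cube _ _ _ (fun z => S (z + w)) (e' + K * `|v|)) => //.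
    exact: (measurable_shift w).
  move=> z /zB zw; rewrite -(subrK (g (z + w)) (S _)) (le_trans (ler_normD _ _))//.
  by rewrite lerD ?Sg// (gradient_bound _ K0 fK (Bx _ zw)).
have inte : leb.-integrable (cube rho) (EFin \o (cst e')).
  by apply: (@integrable_cube _ _ _ (cst e') `|e'|).
have gS : cube_int rho g w <= cube_int rho S w + e' * cube_mass n rho.
  rewrite /cube_mass -Rintegral_cst; last exact: measurable_cube.
  rewrite -RintegralD//; last exact: measurable_cube.
  apply: le_Rintegral => //; first exact: measurable_cube.
    pose Sw (z : E) := S ((z : 'rV[R]_n) + w).
    rewrite (_ : _ \o _ = (EFin \o Sw) \+ (EFin \o cst e'))%E//.
    by apply: integrableD => //; exact: measurable_cube.
  by move=> z /zB zw; rewrite -lerBlDl; have := Sg _ zw; rewrite ler_distl => /andP[]; rewrite /g; lra.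
have SE : cube_int rho S w = cube_mass n rho * sint mu S.
  by rewrite (sint_cube_content w rho0 S) mulrA mulfV ?mul1r// gt_eqF.
rewrite (le_trans gS)// SE.
have Sw : sint mu S <= dotp w' v + e' by move: Sc; rewrite ler_distl => /andP[].
have -> : e = cube_mass n rho * e' + e' * cube_mass n rho.
  by rewrite /e'; field; rewrite gt_eqF.
by rewrite addrA lerD2r -mulrDr ler_pM2l.
Qed.

End cube_contents.

(** * Convex sets *)

Section convex_geometry.
Context {R : realType} {n : nat}.
Implicit Types (C K : set 'rV[R]_n) (v w c p : 'rV[R]_n).

Lemma dotp_sqB (v u : 'rV[R]_n) (l : R) :
  dotp (v - l *: u) (v - l *: u) =
  dotp v v - 2 * l * dotp u v + l * (l * dotp u u).
Proof.
by rewrite -scaleNr dotpDl !dotpDr !dotpZl !dotpZr (dotpC v u); ring.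
Qed.

(** A quantitative separation argument.  If the distance from w to C were positive,
    pick c in C whose squared distance to w is nearly the infimum d.  The
    hypothesis in the direction v = w - c yields c' in C with
    (c' - w).v >= - d / 4; moving from c towards c' by a small amount l then
    decreases the squared distance to w at first order in l, below d. *)
Lemma approx_separation C (M : R) w :
  (forall a b t, C a -> C b -> 0 <= t <= 1 -> C (a + t *: (b - a))) ->
  (forall c, C c -> `|c| <= M) ->
  (forall v e, 0 < e -> exists2 c, C c & dotp w v - e <= dotp c v) ->
  forall e, 0 < e -> exists2 c, C c & `|w - c| < e.
Proof.
move=> convC CM sep e e0; apply: contrapT => far.
pose Q v := dotp v v.
have Qe c : C c -> e ^+ 2 <= Q (w - c).
  move=> Cc; have ec : e <= `|w - c|.
    by rewrite leNgt; apply/negP => ce; apply: far; exists c.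
  rewrite /Q -(sqr_sqrtr (dotp_ge0 (w - c))) ler_sqr ?nnegrE ?sqrtr_ge0 ?(ltW e0)//.
  exact: le_trans ec (norm_le_enorm _).
have [c0 Cc0 _] := sep 0 1 ltr01.
pose S := [set Q (w - c) | c in C].
have S0 : S !=set0 by exists (Q (w - c0)), c0.
have lbS : lbound S (e ^+ 2) by move=> _ [c Cc <-]; exact: Qe.
have hlb : has_lbound S by exists (e ^+ 2).
pose d := inf S.
have d0 : 0 < d.
  by apply: lt_le_trans (lb_le_inf S0 lbS); rewrite exprn_gt0.
have dQ c : C c -> d <= Q (w - c) by move=> Cc; apply: ge_inf => //; exists c.
(* L bounds the squared norms of the differences of points of C *)
pose L := n%:R * (2 * M) ^+ 2.
have M0 : 0 <= M by apply: le_trans (CM _ Cc0).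
have L0 : 0 <= L by rewrite mulr_ge0// sqr_ge0.
have QL a b : C a -> C b -> Q (b - a) <= L.
  move=> /CM aM /CM bM; rewrite (le_trans (ler_norm _))// (le_trans (dotp_le _ _))//.
  rewrite -mulrA ler_wpM2l// -expr2 lerXn2r ?nnegrE ?mulr_ge0//.
  by rewrite (le_trans (ler_normB _ _))//; lra.
(* the second-order term l ^+ 2 * L is then at most l * d / 2 *)
pose l := Num.min 1 (d / (2 * (L + 1))).
have l0 : 0 < l by rewrite lt_min ltr01 divr_gt0// mulr_gt0// ltr_wpDl.
have l1 : l <= 1 by rewrite ge_min lexx.
have lL : l * L <= d / 2.
  have : l * (2 * (L + 1)) <= d by rewrite -ler_pdivlMr ?ge_min ?lexx ?orbT// mulr_gt0// ltr_wpDl.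
  by move: (ltW l0); nra.
have [|q [c Cc <-] Qc] := @inf_lt _ S (d + l * d / 2) S0.
  by rewrite ltrDl divr_gt0// mulr_gt0.
pose v := w - c.
have d4 : 0 < d / 4 by rewrite divr_gt0.
have [c' Cc' c'v] := sep v (d / 4) d4.
have Cnew : C (c + l *: (c' - c)) by apply: convC; rewrite ?l1 ?ltW.
have := dQ _ Cnew.
have -> : w - (c + l *: (c' - c)) = v - l *: (c' - c) by rewrite opprD addrA.
have -> : Q (v - l *: (c' - c)) =
    Q v - 2 * l * dotp (c' - c) v + l * (l * Q (c' - c)).
  exact: dotp_sqB.
have -> : dotp (c' - c) v = dotp (c' - w) v + Q v.
  by rewrite /Q -dotpDl addrA subrK.
have h1 : - (d / 4) <= dotp (c' - w) v by rewrite dotpBl; lra.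
have h2 : d <= Q v by exact: dQ.
have h3 : Q v < d + l * d / 2 by [].
have h4 : l * (l * Q (c' - c)) <= l * (d / 2).
  apply: ler_wpM2l; first exact: ltW.
  by apply: le_trans lL; rewrite ler_wpM2l ?(ltW l0)// QL.
have h5 : l * (d - d / 4) <= l * (dotp (c' - w) v + Q v) by rewrite ler_wpM2l ?(ltW l0)//; lra.
have ld : 0 < l * d by rewrite mulr_gt0.
lra.
Qed.

Definition convex_comb k (a : 'I_k -> R) (p : 'I_k -> 'rV[R]_n) w :=
  [/\ forall i, 0 <= a i, \sum_i a i = 1 & w = \sum_i a i *: p i].

(** The n + 2 vectors (1, p i) of R^(n+1) are linearly dependent.  Subtracting from
    the coefficients a the largest multiple of the dependency u that keeps them
    nonnegative cancels one of them. *)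
Lemma caratheodory_step (a : 'I_n.+2 -> R) (p : 'I_n.+2 -> 'rV[R]_n) w :
  convex_comb a p w -> exists (i0 : 'I_n.+2) (b : 'I_n.+1 -> R),
    convex_comb b (fun j => p (lift i0 j)) w.
Proof.
move=> [a0 a1 wE].
(* the rows of A are the vectors (1, p i), so that u *m A = 0 means that the
   sums of the u i and of the u i *: p i vanish *)
pose A : 'M[R]_(n.+2, n.+1) := \matrix_(i, j) consv 1 (p i) ord0 j.
have kA : kermx A != 0.
  rewrite kermx_eq0 /row_free neq_ltn ltnS.
  by rewrite (leq_trans (rank_leq_col A)).
have [u u0 uA] : exists2 u : 'rV[R]_n.+2, u != 0 & u *m A = 0.
  exists (nz_row (kermx A)); first by rewrite nz_row_eq0.
  by apply/eqP; rewrite -sub_kermx; exact: nz_row_sub.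
have sum_u : \sum_i u ord0 i = 0.
  have := congr1 (fun M : 'rV[R]_n.+1 => M ord0 ord0) uA.
  rewrite !mxE => sum0; rewrite -[RHS]sum0; apply: eq_bigr => i _.
  by rewrite mxE consv0 mulr1.
have sum_up : \sum_i u ord0 i *: p i = 0.
  apply/rV_eq => j.
  have := congr1 (fun M : 'rV[R]_n.+1 => M ord0 (lift ord0 j)) uA.
  rewrite !mxE summxE => sum0; rewrite -[RHS]sum0; apply: eq_bigr => i _.
  by rewrite [in LHS]mxE [in RHS]mxE consvS.
have [i1 ui1] : exists i, 0 < u ord0 i.
  apply: contrapT => neg.
  have un i : 0 <= - u ord0 i.
    by rewrite oppr_ge0 leNgt; apply/negP => ui; apply: neg; exists i.
  case/eqP: u0; apply/rV_eq => i; rewrite mxE; apply: oppr_inj; rewrite oppr0.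
  have /psumr_eq0P : forall i, true -> 0 <= - u ord0 i by move=> ? _; exact: un.
  by apply => //; rewrite sumrN sum_u oppr0.
case: (@arg_minP _ _ _ i1 (fun i => 0 < u ord0 i) (fun i => a i / u ord0 i) ui1).
move=> i0 ui0 min0.
pose tau := a i0 / u ord0 i0.
pose b i := a i - tau * u ord0 i.
have b_i0 : b i0 = 0 by rewrite /b /tau divfK ?subrr// gt_eqF.
exists i0, (fun j => b (lift i0 j)); split.
- move=> j; move: (lift i0 j) => i; rewrite subr_ge0.
  have [ui|ui] := ltP 0 (u ord0 i); first by rewrite -ler_pdivlMr// min0.
  by apply: le_trans (a0 i); rewrite mulr_ge0_le0// divr_ge0// ltW.
- transitivity (\sum_i b i).
    by rewrite (bigD1_ord i0)//= b_i0 add0r.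
  by rewrite sumrB -mulr_sumr sum_u mulr0 subr0.
- transitivity (\sum_i b i *: p i).
    rewrite wE; transitivity (\sum_i (a i *: p i - tau *: (u ord0 i *: p i))).
      by rewrite sumrB -scaler_sumr sum_up scaler0 subr0.
    by apply: eq_bigr => i _; rewrite scalerBl scalerA.
  by rewrite (bigD1_ord i0)//= b_i0 scale0r add0r.
Qed.

(** By induction on the number of points: the points other than the first are
    reduced to n + 1 after normalisation of their coefficients, and
    [caratheodory_step] then removes one of the resulting n + 2 points. *)
Lemma caratheodory K w : conv_hull K w ->
  exists (a : 'I_n.+1 -> R) (p : 'I_n.+1 -> 'rV[R]_n),
    (forall i, K (p i)) /\ convex_comb a p w.
Proof.
move=> [m [a [p [a0 a1 Kp wE]]]].
elim: m a p w a0 a1 Kp wE => [|m IH] a p w a0 a1 Kp wE.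
  by move: a1; rewrite big_ord0 => /eqP; rewrite eq_sym oner_eq0.
rewrite big_ord_recl in a1; rewrite big_ord_recl in wE.
set s := \sum_(i < m) _ in a1.
have s_ge0 : 0 <= s by apply: sumr_ge0.
have [s0|s0] := eqVneq s 0.
  have az i : a (lift ord0 i) = 0 by apply: (psumr_eq0P _ s0).
  have a01 : a ord0 = 1 by rewrite -a1 s0 addr0.
  exists (fun i => (i == ord0)%:R), (fun=> p ord0); split=> //; split.
  - by move=> i; exact: ler0n.
  - by rewrite (bigD1 ord0)//= big1 ?addr0// => i /negbTE ->.
  - rewrite wE big1; last by move=> i _; rewrite az scale0r.
    rewrite (bigD1 ord0)//= big1 ?addr0 ?a01// => i /negbTE ->.
    by rewrite scale0r.
have [||||q [p' [Kp' [q0 q1 wE']]]] :=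
    IH (fun i => s^-1 * a (lift ord0 i)) (fun i => p (lift ord0 i))
       (\sum_(i < m) (s^-1 * a (lift ord0 i)) *: p (lift ord0 i)).
- by move=> i; rewrite mulr_ge0// invr_ge0.
- by rewrite -mulr_sumr mulVf.
- by move=> i; exact: Kp.
- by [].
pose c i := oapp (fun j => s * q j) (a ord0) (unlift ord0 i : option 'I_n.+1).
pose P i := oapp p' (p ord0) (unlift ord0 i : option 'I_n.+1).
have [i0 [b bw]] : exists (i0 : 'I_n.+2) (b : 'I_n.+1 -> R),
    convex_comb b (fun j => P (lift i0 j)) w.
  apply: (@caratheodory_step c); split.
  - by move=> i; rewrite /c; case: unliftP => //= j _; rewrite mulr_ge0.
  - rewrite big_ord_recl /c unlift_none /= -[RHS]a1; congr (_ + _).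
    under eq_bigr do rewrite liftK /=.
    by rewrite -mulr_sumr q1 mulr1.
  - rewrite big_ord_recl /c /P unlift_none /= wE; congr (_ + _).
    under [RHS]eq_bigr do rewrite liftK /= -scalerA.
    rewrite -scaler_sumr -wE' scaler_sumr; apply: eq_bigr => i _.
    by rewrite scalerA mulrA divff// mul1r.
exists b, (fun j => P (lift i0 j)); split => // j.
by rewrite /P; case: unliftP => //=.
Qed.

(** By Caratheodory's theorem the points of the hull are combinations of a fixed
    number of points; coefficients and points converge along an ultrafilter. *)
Lemma conv_hull_closed K (M : R) :
  (forall p, K p -> `|p| <= M) ->
  (forall p, (forall e, 0 < e -> exists2 q, K q & `|p - q| < e) -> K p) ->
  forall w, (forall e, 0 < e -> exists2 c, conv_hull K c & `|w - c| < e) ->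
  conv_hull K w.
Proof.
move=> KM closedK w approx.
have /choice[ap ap_] : forall k : nat,
    exists ap : ('I_n.+1 -> R) * ('I_n.+1 -> 'rV[R]_n),
    [/\ forall i, 0 <= ap.1 i, \sum_i ap.1 i = 1, forall i, K (ap.2 i)
      & `|w - \sum_i ap.1 i *: ap.2 i| < k.+1%:R^-1].
  move=> k; have [|c Kc wc] := approx (k.+1%:R^-1); first by rewrite invr_gt0.
  have [a [p [Kp [a0 a1 cE]]]] := caratheodory Kc.
  by exists (a, p); split => //=; rewrite -cE.
have [U [UU Uinf]] := nat_ultrafilter.
have /choice[a aP] : forall i : 'I_n.+1, exists l : R,
    (fun k => (ap k).1 i) @ U --> l.
  move=> i; apply: (@ultra_cvg _ _ _ _ 1) => k.
  have [a0 a1 _ _] := ap_ k.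
  by rewrite ger0_norm// -a1 (bigD1 i)//= lerDl sumr_ge0.
have /choice[p pP] : forall i : 'I_n.+1, exists l : 'rV[R]_n,
    forall e, 0 < e -> U [set k | `|(ap k).2 i - l| < e].
  by move=> i; apply: (@ultra_cvg_rV _ _ _ _ _ M) => k; apply: KM; have [] := ap_ k.
have pjP i j : (fun k => (ap k).2 i ord0 j) @ U --> p i ord0 j.
  apply/cvgrPdist_lt => e e0; apply: filterS (pP i _ e0) => k /=.
  apply: le_lt_trans; rewrite distrC.
  by have := rV_norm_coord ((ap k).2 i - p i) j; rewrite !mxE.
exists n.+1, a, p; split.
- move=> i; apply: (ler_cvg_to (cvg_cst (0 : R)) (aP i)).
  by apply: nearW => k; have [] := ap_ k.
- apply: (@ultra_unique _ U _ (fun k => \sum_i (ap k).1 i)).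
    by by apply: cvg_big => [|i _]; [exact: add_continuous|exact: aP].
  have -> : (fun k => \sum_i (ap k).1 i) = (fun=> 1).
    by apply/funext => k; have [] := ap_ k.
  exact: cvg_cst.
- move=> i; apply: closedK => e e0.
  have [k kP] := filter_ex (pP i _ e0).
  by exists ((ap k).2 i); [have [] := ap_ k|rewrite distrC].
- apply/rV_eq => j; rewrite summxE.
  apply: (@ultra_unique _ U _ (fun k => \sum_i (ap k).1 i * (ap k).2 i ord0 j)).
    apply/cvgrPdist_lt => e e0.
    have [k0 _ k0P] := near_infty_natSinv_lt (PosNum e0).
    apply: filterS (Uinf k0) => k /= ke.
    have [_ _ _ wk] := ap_ k.
    apply: le_lt_trans (lt_trans wk (k0P _ ke)).
    have -> : w ord0 j - \sum_i (ap k).1 i * (ap k).2 i ord0 j =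
        (w - \sum_i (ap k).1 i *: (ap k).2 i) ord0 j.
      rewrite !mxE summxE; congr (_ - _); apply: eq_bigr => i _.
      by rewrite mxE.
    exact: rV_norm_coord.
  under [X in _ --> X]eq_bigr do rewrite mxE.
  apply: cvg_big => [|i _]; first exact: add_continuous.
  by apply: cvgM; [exact: aP|exact: pjP].
Qed.

End convex_geometry.

(** * The set of density integrals and Clarke's gradient *)

Section density_set.
Context {R : realType} {n : nat}.
Notation E := (borel_rV R n).
Implicit Types (mu : {content set E -> \bar R}) (v w x y : 'rV[R]_n).

Lemma full_superset mu (B B' : set E) : mu setT = 1%E ->
  measurable B -> measurable B' -> mu B = 1%E -> B `<=` B' -> mu B' = 1%E.
Proof.
move=> muT mB mB' B1 BB'; apply/eqP; rewrite eq_le content_le1//= -B1.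
by apply: le_measure => //; exact/mem_set.
Qed.

(** Convex combination of two contents, which makes the set of density integrals
    convex. *)
Lemma mixture_content mu1 mu2 (t : R) : mu1 setT = 1%E -> mu2 setT = 1%E ->
  0 <= t <= 1 -> exists mu,
  (forall A, measurable A ->
    mu A = ((1 - t) * mass mu1 A + t * mass mu2 A)%:E).
Proof.
move=> T1 T2 /andP[t0 t1].
pose m A : \bar R := ((1 - t) * mass mu1 A + t * mass mu2 A)%:E.
have ge0 A : (0 <= m A)%E.
  by rewrite lee_fin addr_ge0// mulr_ge0// ?mass_ge0// subr_ge0.
have add : measure_function.semi_additive m.
  move=> F k mF tF mUF; rewrite /m sumEFin; congr EFin.
  have massU mu : mu setT = 1%E ->
      mass mu (\big[setU/set0]_(i < k) F i) = \sum_(i < k) mass mu (F i).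
    move=> muT; rewrite {1}/mass measure_semi_additive//.
    by under eq_bigr do rewrite (massE muT (mF _)); rewrite sumEFin.
  by rewrite !massU// !mulr_sumr -big_split.
pose mu : {content set E -> \bar R} := HB.pack m
  (isContent.Build _ E R m ge0 add).
by exists mu.
Qed.

Variables (f : 'rV[R]_n -> R) (x : 'rV[R]_n).
Hypothesis lf : loclip f.

Lemma density_integralsP w : density_integrals f x w ->
  exists2 mu, density_measure x mu &
    forall delta, 0 < delta -> grad_mean f mu (eball x delta) w.
Proof.
move=> [mu [mu0 mu1 muT] muw]; exists mu => // delta d0 i.
apply/fa_integral_approx => //; last exact: muw.
  exact: measurable_eball.
exact: mu1.
Qed.

Lemma density_integrals_convex a b (t : R) :
  density_integrals f x a -> density_integrals f x b -> 0 <= t <= 1 ->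
  density_integrals f x (a + t *: (b - a)).
Proof.
move=> /density_integralsP[mu1 [null1 ball1 T1] mean1].
move=> /density_integralsP[mu2 [null2 ball2 T2] mean2] t01.
have [mu muE] := mixture_content T1 T2 t01.
have full A : measurable A -> mu1 A = 1%E -> mu2 A = 1%E -> mu A = 1%E.
  by move=> mA A1 A2; rewrite muE// /mass A1 A2 !mulr1 subrK.
have muT : mu setT = 1%E by exact: full.
have ball d : 0 < d -> mu (eball x d) = 1%E.
  by move=> d0; apply: full; rewrite ?ball1 ?ball2//; exact: measurable_eball.
exists mu.
  by split=> // A mA A0; rewrite muE// /mass null1// null2// !mulr0 addr0.
move=> delta i d0; apply/fa_integral_approx => //; first exact: measurable_eball.
  exact: ball.
move=> e e0.
have [s sP sa] := mean1 _ d0 i e e0.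
have sb := sint_approxE T2 (measurable_eball x delta) (ball2 _ d0)
  (measurable_eball x delta) (ball2 _ d0) (mean2 _ d0 i) sP.
exists s => //.
have -> : sint mu s = (1 - t) * sint mu1 s + t * sint mu2 s.
  rewrite !sfun_fibers// !mulr_sumr -big_split/=; apply: eq_bigr => c _.
  by rewrite {1}/mass muE//=; ring.
rewrite !mxE.
have -> : (1 - t) * sint mu1 s + t * sint mu2 s -
    (a ord0 i + t * (b ord0 i - a ord0 i)) =
    (1 - t) * (sint mu1 s - a ord0 i) + t * (sint mu2 s - b ord0 i) by ring.
case/andP: t01 => t0 t1; have t1' : 0 <= 1 - t by rewrite subr_ge0.
rewrite (le_trans (ler_normD _ _))// !normrM (ger0_norm t0) (ger0_norm t1').
by move: sa sb; nra.
Qed.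

Lemma density_integrals_bounded r (K : R) : 0 < r -> 0 <= K ->
  ball_lipschitz f x r K ->
  forall w, density_integrals f x w -> `|w| <= K.
Proof.
move=> r0 K0 fK w /density_integralsP[mu [_ ball1 muT] mean].
apply: (grad_mean_norm_le muT (measurable_eball x r) (ball1 _ r0) (mean _ r0)
  K0 fK) => y yx.
exact: le_lt_trans (norm_le_enorm _) yx.
Qed.

Lemma density_integrals_closed w :
  (forall e, 0 < e -> exists2 c, density_integrals f x c & `|w - c| < e) ->
  density_integrals f x w.
Proof.
move=> approx.
have /choice[q qP] : forall k : nat, exists q : {content set E -> \bar R} * 'rV[R]_n,
    [/\ density_measure x q.1, grad_mean f q.1 (eball x 1) q.2 &
      `|w - q.2| < k.+1%:R^-1].
  move=> k; have [|c cD wc] := approx k.+1%:R^-1; first by rewrite invr_gt0.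
  by have [mu mux muc] := density_integralsP cD; exists (mu, c); split => //; exact: muc.
have [U [UU Uinf]] := nat_ultrafilter.
apply: (density_limit lf UU (mu_ := fun k => (q k).1) (B_ := fun=> eball x 1)
  (w_ := fun k => (q k).2)).
- by move=> k; have [[]] := qP k.
- by move=> k A; have [[+ _ _] _ _] := qP k; exact.
- by move=> _; exact: measurable_eball.
- by move=> k; have [[_ ball1 _] _ _] := qP k; exact: ball1.
- by move=> k; have [] := qP k.
- move=> d d0; apply: filterE => k /=.
  by have [[_ ball1 _] _ _] := qP k; exact: ball1.
- move=> e e0; have [k0 _ k0P] := near_infty_natSinv_lt (PosNum e0).
  apply: filterS (Uinf k0) => k /= ke; have [_ _ wk] := qP k.
  by rewrite distrC; exact: lt_trans wk (k0P _ ke).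
Qed.

Lemma clarke_quotient w v eta : clarke_gradient f x w -> 0 < eta ->
  exists y t, [/\ `|y - x| < eta, 0 < t < eta &
    dotp w v - eta <= (f (y + t *: v) - f y) / t].
Proof.
move=> /(_ v) wC eta0.
pose V := [set p : 'rV[R]_n * R | `|p.1 - x| < eta /\ 0 < p.2 < eta].
pose g (p : 'rV[R]_n * R) := ((f (p.1 + p.2 *: v) - f p.1) / p.2)%:E.
have FV : filter_prod (nbhs x) (at_right 0) V.
  exists ([set y | `|y - x| < eta], [set t | 0 < t < eta]) => /=.
    split.
      apply/nbhs_ballP; exists eta => //= y; rewrite -ball_normE/= distrC.
      exact.
    near=> t; apply/andP; split; first by near: t; exact: nbhs_right_gt.
    by near: t; exact: nbhs_right_lt.
  by move=> [y t].
have wV : ((dotp w v)%:E <= ereal_sup (g @` V))%E.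
  by apply: le_trans wC _; apply: ereal_inf_lbound; exists V.
have [|_ [[y t] [yx t0] <-]] := @ereal_sup_gt _ (g @` V) (dotp w v - eta)%:E.
  by apply: lt_le_trans wV; rewrite lte_fin; lra.
by rewrite /g/= lte_fin => /ltW wq; exists y, t.
Unshelve. all: by end_near. Qed.

(** A difference quotient near x, nearly as large as w.v, is turned into a mean of
    Df over a cube inside the ball of radius eta.  The radius rho of the cube is
    chosen after the increment t, so that the error 2 K rho / t of
    [cube_int_slope] is small. *)
Lemma clarke_mean r K w v eta : 0 < r -> 0 <= K -> ball_lipschitz f x r K ->
  clarke_gradient f x w -> 0 < eta ->
  exists mu, exists B : set E, exists w' : 'rV[R]_n,
  [/\ [/\ mu setT = 1%E,
      forall A : set E, measurable A -> lebesgue_rV A = 0%E -> mu A = 0%E,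
      measurable B & mu B = 1%E],
      forall y, B y -> `|y - x| < eta, grad_mean f mu B w',
      `|w'| <= K & dotp w v - eta <= dotp w' v].
Proof.
move=> r0 K0 fK wC eta0.
pose m := Num.min eta r.
have m0 : 0 < m by rewrite lt_min eta0.
have meta : m <= eta by rewrite ge_min lexx.
have mr : m <= r by rewrite ge_min lexx orbT.
have v0 : 0 <= `|v| by [].
(* then y + s v stays within m / 2 of x for 0 <= s <= t < e *)
pose e := m / (2 * (`|v| + 1)).
have e0 : 0 < e by rewrite divr_gt0// mulr_gt0// ltr_wpDl.
have eE : e * `|v| + e = m / 2.
  by rewrite /e; field; rewrite gt_eqF// ltr_wpDl.
have em : e <= m / 2 by rewrite -eE lerDr mulr_ge0// ltW.
have [y [t [yx /andP[t0 te] wq]]] := clarke_quotient v wC e0.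
pose rho := Num.min (m / 4) (t * eta / (4 * (K + 1))).
have K1 : 0 < 4 * (K + 1) by rewrite mulr_gt0// ltr_wpDl.
have rho0 : 0 < rho by rewrite lt_min !divr_gt0// mulr_gt0.
have rhom : rho <= m / 4 by rewrite ge_min lexx.
have Krho : 2 * K * rho <= t * eta / 2.
  have : rho * (4 * (K + 1)) <= t * eta.
    by rewrite -ler_pdivlMr// ge_min lexx orbT.
  by nra.
have seg s : 0 <= s <= t -> `|y + s *: v - x| + rho < m.
  move=> /andP[s0 st]; rewrite addrAC.
  have h1 := ler_normD (y - x) (s *: v).
  have h2 : `|s *: v| <= e * `|v|.
    by rewrite normrZ (ger0_norm s0) ler_wpM2r// (le_trans st)// ltW.
  by lra.
have [s st sl] := cube_int_slope lf K0 fK rho0 t0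
  (fun s st => lt_le_trans (seg s st) mr).
have [mu [w' [muT mu0 mu1 muw [w'K w'v]]]] :=
  cube_mean v lf K0 fK rho0 (lt_le_trans (seg s st) mr).
exists mu, [set z : 'rV[R]_n | `|z - (y + s *: v)| < rho], w'; split => //.
- split => //; apply: open_measurable_rV; apply: open_rV_norm => z /= zr.
  exists (rho - `|z - (y + s *: v)|); first by rewrite subr_gt0.
  move=> z' z'z; rewrite -(subrKA z) (le_lt_trans (ler_normD _ _))//.
  by rewrite -ltrBrDr.
- move=> z /= zB; rewrite -(subrKA (y + s *: v)).
  have := seg s st.
  have := ler_normD (z - (y + s *: v)) (y + s *: v - x).
  lra.
- have cm := cube_mass_gt0 n rho0.
  have h : f (y + t *: v) - f y - 2 * K * rho <= dotp w' v * t.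
    rewrite -(ler_pM2r cm) (le_trans sl)// mulrAC ler_wpM2r ?(ltW t0)//.
    by rewrite mulrC.
  have {}wq : (dotp w v - e) * t <= f (y + t *: v) - f y by rewrite -ler_pdivlMr.
  have : (dotp w v - eta) * t <= dotp w' v * t.
    have : e * t <= eta / 2 * t by rewrite ler_wpM2r// ?(ltW t0)//; lra.
    lra.
  by rewrite ler_pM2r.
Qed.

End density_set.

(** * Inclusions between the three sets *)

Section equality.
Context {R : realType} {n : nat}.
Notation E := (borel_rV R n).
Implicit Types (N : set 'rV[R]_n) (v w x y : 'rV[R]_n).
Variable f : 'rV[R]_n -> R.
Hypothesis lf : loclip f.

Lemma dotp_near (v w : 'rV[R]_n) (e : R) : 0 < e ->
  exists2 d, 0 < d & forall w', `|w' - w| < d -> `|dotp w' v - dotp w v| <= e.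
Proof.
move=> e0; have c0 : 0 <= n%:R * `|v| by rewrite mulr_ge0.
exists (e / (n%:R * `|v| + 1)) => [|u]; first by rewrite divr_gt0// ltr_wpDl.
rewrite ltr_pdivlMr ?ltr_wpDl// => ud.
rewrite -dotpBl (le_trans (dotp_le _ _))// mulrAC mulrC (le_trans _ (ltW ud))//.
by rewrite ler_wpM2l// lerDl.
Qed.

Lemma dotp_sum k (a : 'I_k -> R) (p : 'I_k -> 'rV[R]_n) v :
  dotp (\sum_i a i *: p i) v = \sum_i a i * dotp (p i) v.
Proof.
rewrite (big_morph (fun u => dotp u v) (fun a b => dotpDl a b v) (dotp0l v)).
by apply: eq_bigr => i _; rewrite dotpZl.
Qed.

(** In each direction, the means of [clarke_mean] for eta = 1/(k+1) have a density
    integral as limit. *)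
Lemma clarke_sub_density x : clarke_gradient f x `<=` density_integrals f x.
Proof.
move=> w wC; have [r [K [r0 K0 fK]]] := lf x.
apply: density_integrals_closed => //.
apply: (@approx_separation _ _ _ K); first exact: density_integrals_convex.
  exact: (density_integrals_bounded r0 K0 fK).
move=> v e e0.
have /choice[q qP] : forall k : nat, exists q : {content set E -> \bar R} * set E * 'rV[R]_n,
  [/\ [/\ q.1.1 setT = 1%E,
      forall A : set E, measurable A -> lebesgue_rV A = 0%E -> q.1.1 A = 0%E,
      measurable q.1.2 & q.1.1 q.1.2 = 1%E],
      forall y, q.1.2 y -> `|y - x| < k.+1%:R^-1, grad_mean f q.1.1 q.1.2 q.2,
      `|q.2| <= K & dotp w v - k.+1%:R^-1 <= dotp q.2 v].
  move=> k; have k0 : 0 < k.+1%:R^-1 :> R by rewrite invr_gt0.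
  by have [mu [B [w' ?]]] := clarke_mean lf v r0 K0 fK wC k0; exists (mu, B, w').
have [U [UU Uinf]] := nat_ultrafilter.
have small e' : 0 < e' -> U [set k | k.+1%:R^-1 < e' :> R].
  move=> e'0; have [k0 _ k0P] := near_infty_natSinv_lt (PosNum e'0).
  by apply: filterS (Uinf k0) => k /= ke; exact: k0P.
have [c cP] := @ultra_cvg_rV _ _ UU _ (fun k => (q k).2) K
  (fun k => let: And5 _ _ _ h _ := qP k in h).
exists c.
  apply: (density_limit lf UU (mu_ := fun k => (q k).1.1)
    (B_ := fun k => (q k).1.2) (w_ := fun k => (q k).2)) => //.
  - by move=> k; have [[]] := qP k.
  - by move=> k; have [[]] := qP k.
  - by move=> k; have [[]] := qP k.
  - by move=> k; have [[]] := qP k.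
  - by move=> k; have [] := qP k.
  - move=> d d0; have n1 : 0 < n%:R + 1 :> R by rewrite ltr_wpDl.
    apply: filterS (small _ (divr_gt0 d0 n1)) => k /=.
    rewrite ltr_pdivlMr// => kd; have [[muT _ mB B1] Bk _ _ _] := qP k.
    apply: (full_superset muT mB (measurable_eball x d) B1) => y /Bk yk.
    rewrite /eball/= (le_lt_trans (enorm_le_norm _))// (le_lt_trans _ kd)//.
    by rewrite mulrC ler_wpM2r ?(ltW n1)// ltW.
have [d d0 dP] := dotp_near v c (divr_gt0 e0 (ltr0n R 2)).
have /filter_ex[k [/= k1 k2]] : U ([set k | `|(q k).2 - c| < d] `&`
    [set k | k.+1%:R^-1 < e / 2]).
  by apply: filterI; [exact: cP|apply: small; lra].
have [_ _ _ _ qv] := qP k.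
move: (dP _ k1) qv k2; rewrite ler_distl; move: (k.+1%:R^-1) => z.
lra.
Qed.

(** Sequences are replaced by e-neighbourhoods, a form in which closedness is
    plain. *)
Lemma limiting_gradientsP N x w : limiting_gradients f N x w <->
  forall e, 0 < e -> exists y,
    [/\ differentiable f y, ~ N y, `|y - x| < e & `|grad f y - w| < e].
Proof.
split=> [[s [sx sN sw]] e e0|sw].
  move/cvgrPdist_lt : sx => /(_ _ e0) sx; move/cvgrPdist_lt : sw => /(_ _ e0) sw.
  have /filter_ex[k [/= k1 k2]] := @filterI _ _ eventually_filter _ _ sx sw.
  by have [? ?] := sN k; exists (s k); split; rewrite // distrC.
have /choice[s sP] : forall k : nat, exists y,
    [/\ differentiable f y, ~ N y, `|y - x| < k.+1%:R^-1 &
        `|grad f y - w| < k.+1%:R^-1].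
  by move=> k; apply: sw; rewrite invr_gt0.
exists s; split.
- apply/cvgrPdist_lt => e e0; near=> k; rewrite distrC.
  have [_ _ + _] := sP k; move=> /lt_trans; apply.
  by near: k; exact: (near_infty_natSinv_lt (PosNum e0)).
- by move=> k; have [] := sP k.
- apply/cvgrPdist_lt => e e0; near=> k; rewrite distrC.
  have [_ _ _] := sP k; move=> /lt_trans; apply.
  by near: k; exact: (near_infty_natSinv_lt (PosNum e0)).
Unshelve. all: by end_near. Qed.

Lemma limiting_gradients_closed N x w :
  (forall e, 0 < e -> exists2 c, limiting_gradients f N x c & `|w - c| < e) ->
  limiting_gradients f N x w.
Proof.
move=> approx; apply/limiting_gradientsP => e e0.
have e2 : 0 < e / 2 by lra.
have [c /limiting_gradientsP/(_ _ e2)[y [dy Ny yx yc]] wc] := approx _ e2.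
exists y; split=> //; first by lra.
rewrite -(subrKA c) (le_lt_trans (ler_normD _ _))// (distrC c).
lra.
Qed.

Lemma limiting_gradients_bounded N x r (K : R) w : 0 < r -> 0 <= K ->
  ball_lipschitz f x r K -> limiting_gradients f N x w -> `|w| <= K.
Proof.
move=> r0 K0 fK /limiting_gradientsP wP; apply/ler_addgt0Pr => e e0.
have [|y [_ _ yx yw]] := wP (Num.min r e); first by rewrite lt_min r0.
move: yx yw; rewrite !lt_min => /andP[yr _] /andP[_ ye].
rewrite -(subKr (grad f y) w) (le_trans (ler_normB _ _))//.
by rewrite lerD// ?(grad_norm_bound K0 fK yr)// ltW.
Qed.

(** A neighbourhood of (x, 0) contains (y, t) for y of differentiability close to x
    and t small with respect to y; the difference quotient there is close to
    Df(y).v, hence to w.v. *)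
Lemma limiting_sub_clarke N x : limiting_gradients f N x `<=` clarke_gradient f x.
Proof.
move=> w /limiting_gradientsP wP v; apply: le_ereal_inf_tmp => _ [V FV <-].
case: FV => -[A B] /= [/nbhs_ballP[a /= a0 aA] [b /= b0 bB]] ABV.
apply/lee_addgt0Pr => e e0; have e2 : 0 < e / 2 by lra.
have [d d0 dP] := dotp_near v w e2.
have [|y [dy _ yx yw]] := wP (Num.min a d); first by rewrite lt_min a0.
move: yx yw; rewrite !lt_min => /andP[ya _] /andP[_ /dP yd].
have v1 : 0 < `|v| + 1 by rewrite ltr_wpDl.
have [h h0 hP] := diff_is_gradient dy (divr_gt0 e2 v1).
pose t := Num.min (b / 2) (h / (2 * (`|v| + 1))).
have t0 : 0 < t by rewrite lt_min !divr_gt0// mulr_gt0.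
have tb : t < b by rewrite gt_min ltr_pdivrMr// ltr_pMr// ltr1n.
have th : t * (2 * (`|v| + 1)) <= h.
  by rewrite -ler_pdivlMr ?mulr_gt0// ge_min lexx orbT.
have tv : `|t *: v| = t * `|v| by rewrite normrZ gtr0_norm.
have tvh : `|t *: v| < h by rewrite tv; have := normr_ge0 v; nra.
have := hP _ tvh; rewrite tv addr0 dotpZr.
rewrite ler_distl => /andP[lo _].
have qV : ((f (y + t *: v) - f y) / t)%:E \in
    [set ((f (p.1 + p.2 *: v) - f p.1) / p.2)%:E | p in V].
  rewrite inE; exists (y, t) => //; apply: ABV; split => /=.
    by apply: aA; rewrite -ball_normE/= distrC.
  by apply: bB => //=; rewrite sub0r normrN gtr0_norm.
apply: le_trans (leeD2r _ (ereal_sup_ubound (set_mem qV))).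
rewrite -EFinD lee_fin -lerBlDr ler_pdivlMr//.
have vt : e / 2 / (`|v| + 1) * (t * `|v|) <= e / 2 * t.
  rewrite (mulrC t) mulrA ler_pM2r// mulrAC ler_pdivrMr// ler_pM2l//.
  by rewrite lerDl.
move: yd; rewrite ler_distl => /andP[/(ler_wpM2r (ltW t0)) yd _].
lra.
Qed.

(** The inequalities that define Clarke's gradient are affine in w.  The value of
    the Clarke derivative may a priori be infinite: -oo is excluded because a convex
    combination has at least one point. *)
Lemma conv_hull_sub_clarke N x :
  conv_hull (limiting_gradients f N x) `<=` clarke_gradient f x.
Proof.
move=> w [m [a [p [a0 a1 pL ->]]]] v.
have pC i : ((dotp (p i) v)%:E <= clarke_dd f x v)%E.
  exact: (limiting_sub_clarke (pL i)).
rewrite dotp_sum; case: (clarke_dd f x v) pC => [c||] pC; last 2 first.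
- by rewrite leey.
- case: m a p a0 a1 pL pC => [|m] a p a0 a1 _ pC; last by have := pC ord0.
  by move: a1; rewrite big_ord0 => /eqP; rewrite eq_sym oner_eq0.
rewrite lee_fin -[leRHS]mul1r -a1 mulr_suml; apply: ler_sum => i _.
by rewrite ler_wpM2l// -lee_fin.
Qed.

Lemma conv_hull_convex (C : set 'rV[R]_n) a b (t : R) :
  conv_hull C a -> conv_hull C b -> 0 <= t <= 1 ->
  conv_hull C (a + t *: (b - a)).
Proof.
move=> [m1 [c1 [p1 [c10 c11 Cp1 aE]]]] [m2 [c2 [p2 [c20 c21 Cp2 bE]]]] /andP[t0 t1].
exists (m1 + m2)%N,
  (fun i => match fintype.split i with inl j => (1 - t) * c1 j | inr j => t * c2 j end),
  (fun i => match fintype.split i with inl j => p1 j | inr j => p2 j end).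
split.
- move=> i; case: fintype.split => j; rewrite mulr_ge0//.
  by rewrite subr_ge0.
- rewrite big_split_ord/=.
  under eq_bigr do rewrite (unsplitK (inl _)).
  under [X in _ + X]eq_bigr do rewrite (unsplitK (inr _)).
  by rewrite -!mulr_sumr c11 c21 !mulr1 subrK.
- by move=> i; case: fintype.split.
- rewrite big_split_ord/=.
  under [X in _ = X + _]eq_bigr do rewrite (unsplitK (inl _)) -scalerA.
  under [X in _ = _ + X]eq_bigr do rewrite (unsplitK (inr _)) -scalerA.
  rewrite -!scaler_sumr -aE -bE scalerBr scalerBl scale1r addrA.
  by rewrite addrAC.
Qed.

Lemma conv_hull_bounded (C : set 'rV[R]_n) (K : R) :
  (forall p, C p -> `|p| <= K) -> forall w, conv_hull C w -> `|w| <= K.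
Proof.
move=> CK w [m [a [p [a0 a1 Cp ->]]]].
rewrite (le_trans (ler_norm_sum _ _ _))// -[leRHS]mul1r -a1 mulr_suml.
by apply: ler_sum => i _; rewrite normrZ ger0_norm// ler_wpM2l// CK.
Qed.

Lemma sub_conv_hull (C : set 'rV[R]_n) : C `<=` conv_hull C.
Proof.
move=> w Cw; exists 1%N, (fun=> 1), (fun=> w); split => //.
- by rewrite big_ord1.
- by rewrite big_ord1 scale1r.
Qed.

Lemma co_null (mu : {content set E -> \bar R}) (Z : set E) : mu setT = 1%E ->
  measurable Z -> mu Z = 0%E -> mu (~` Z) = 1%E.
Proof.
move=> muT mZ Z0; rewrite -muT -(setUv Z) measureU ?setICr ?Z0 ?add0e//.
exact: measurableC.
Qed.

(** In each direction v, a limiting gradient p with p.v >= w.v - e is found by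
    contradiction: otherwise Df.v <= w.v - e / 2 on a set of full measure close
    to x, against [mean_le]. *)
Lemma density_sub_conv_hull N x : negligible (@lebesgue_rV R n) N ->
  density_integrals f x `<=` conv_hull (limiting_gradients f N x).
Proof.
move=> [A [mA A0 NA]] w /density_integralsP[mu [null ball1 muT] mean].
have [r [K [r0 K0 fK]]] := lf x.
pose L := limiting_gradients f N x.
have LK p : L p -> `|p| <= K by exact: (limiting_gradients_bounded r0 K0 fK).
apply: (conv_hull_closed LK); first exact: limiting_gradients_closed.
apply: (@approx_separation _ _ _ K); first exact: conv_hull_convex.
  exact: conv_hull_bounded.
move=> v e e0.
pose D : set E := [set y | differentiable f y].
have mD : measurable D.
  by apply: measurable_differentiable; exact: loclip_continuous.
pose G := ~` A `&` D.
have mG : measurable G by apply: measurableI => //; exact: measurableC.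
have D1 : mu D = 1%E.
  rewrite -[D]setCK; apply: co_null => //; first exact: measurableC.
  apply: null; first exact: measurableC.
  by rewrite -lebmE; exact: rademacher.
have G1 : mu G = 1%E.
  rewrite full_setI//; first exact: measurableC.
  by apply: co_null => //; exact: null.
have /choice[y yP] : forall k : nat, exists y,
    [/\ differentiable f y, ~ N y, `|y - x| < Num.min r k.+1%:R^-1 &
        dotp w v - e / 2 < dotp (grad f y) v].
  move=> k; apply: contrapT => nex.
  have d0 : 0 < Num.min r k.+1%:R^-1 by rewrite lt_min r0 invr_gt0/=.
  suff : dotp w v <= dotp w v - e / 2 by lra.
  apply: (mean_le muT (measurable_eball x _) (ball1 _ d0) mG G1 (mean _ d0)).
  move=> y yx [nA dy]; rewrite leNgt; apply/negP => yv; apply: nex; exists y.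
  split => //; first by move=> /NA.
  exact: le_lt_trans (norm_le_enorm _) yx.
have [U [UU Uinf]] := nat_ultrafilter.
have [|c cP] := @ultra_cvg_rV _ _ UU _ (fun k => grad f (y k)) K.
  move=> k; have [_ _ + _] := yP k; rewrite lt_min => /andP[yr _].
  exact: grad_norm_bound K0 fK yr.
exists c; first apply: sub_conv_hull.
  apply/limiting_gradientsP => e' e'0.
  have [k0 _ k0P] := near_infty_natSinv_lt (PosNum e'0).
  have /filter_ex[k [/= k1 k2]] : U ([set k | `|grad f (y k) - c| < e'] `&`
    [set k | (k0 <= k)%N]) by apply: filterI; [exact: cP|exact: Uinf].
  have [dy Ny + _] := yP k; rewrite lt_min => /andP[_ yk].
  by exists (y k); split => //; exact: lt_trans yk (k0P _ k2).
have [d d0 dP] := dotp_near v c (divr_gt0 e0 (ltr0n R 2)).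
have [k /dP] := filter_ex (cP _ d0).
have [_ _ _] := yP k; rewrite ler_distl.
lra.
Qed.

End equality.

Theorem theorem7p2 (R : realType) (n : nat) (f : 'rV[R]_n -> R)
    (N : set 'rV[R]_n) (x : 'rV[R]_n)
    (hf : locally_lipschitz f) (hN : negligible (@lebesgue_rV R n) N) :
  clarke_gradient f x = conv_hull (limiting_gradients f N x) /\
  conv_hull (limiting_gradients f N x) = density_integrals f x.
Proof.
have lf := locally_lipschitz_loclip hf.
have clarke_density := @clarke_sub_density R n f lf x.
have density_conv := @density_sub_conv_hull R n f lf N x hN.
have conv_clarke := @conv_hull_sub_clarke R n f N x.
split; apply/seteqP; split => w.
- by move/clarke_density/density_conv.
- exact: conv_clarke.
- by move/conv_clarke/clarke_density.
- exact: density_conv.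
Qed.
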